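(* For any $L\ge\mu>0$ with $L>24\mu$, and any $d\in\mathbb{N}$, there exists an $L$-smooth $\mu$-strongly convex decentralized problem $\mathcal{DP}$ with sufficiently large $\chi(\mathcal{DP})=\chi$ and $n(\mathcal{DP})=n$ (i.e. larger than any prescribed bound), such that $\Delta(\mathcal{DP})\le 12(d-1)$ and, for any first-order decentralized algorithm, the number of communication rounds needed to find an $\varepsilon$-accurate solution of $\min_x f(x)$ is lower bounded by $$\Omega\left(\chi^{\frac{d}{d+1}}\sqrt{L/\mu}\,\log\frac1\varepsilon\right).$$
   Context: $\mathbb{N}=\{1,2,\dots\}$. All objective functions are defined on the Hilbert space $\ell_2$ with its usual norm $\|\cdot\|$. A differentiable function $h$ is $L$-smooth if $\|\nabla h(y)-\nabla h(x)\|\le L\|y-x\|$ for all $x,y$, and $\mu$-strongly convex if $h(y)\ge h(x)+\langle\nabla h(x),y-x\rangle+\frac{\mu}{2}\|y-x\|^2$ for all $x,y$. Decentralized problem. A decentralized time-varying problem $\mathcal{DP}$ is a pair $(\{\mathcal G_k\}_{k=1}^\infty,\{f_i\}_{i=1}^n)$, where $\mathcal G_k=(\mathcal V,\mathcal E_k)$ are undirected connected graphs on the common vertex set $\mathcal V=\{1,\dots,n\}$, and $f_i$ is a convex function with Lipschitz gradient held by node $i$. Set $f(x)=\frac1n\sum_{i=1}^n f_i(x)$ (the global function); $\mathcal{DP}$ is called $L$-smooth (resp. $\mu$-strongly convex) if $f$ is. Let $x_*$ denote the minimizer of $f$. Put $n(\mathcal{DP})=n$. For a connected graph $\mathcal G$,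 let $\chi(\mathcal G)=\lambda_{\max}/\lambda_{\min}^+$ be the ratio of the largest to the smallest nonzero eigenvalue of the graph Laplacian (degree matrix minus adjacency matrix) of $\mathcal G$, and put $\chi(\mathcal{DP})=\sup_k\chi(\mathcal G_k)$. Put $\Delta(\mathcal{DP})=\max_{k\in\mathbb N}|(\mathcal E_k\setminus\mathcal E_{k+1})\cup(\mathcal E_{k+1}\setminus\mathcal E_k)|$, the maximum number of edges changed between consecutive communication rounds. First-order decentralized algorithm. Each node $i$ has a local memory $\mathcal H_i(k)\subseteq\ell_2$ at time step $k=0,1,2,\dots$, with $\mathcal H_i(0)=\{x_0\}$, $x_0=0$. At each time step $k$ the algorithm performs one of the following. (1) A local computation: $\mathcal H_i(k+1)\subseteq\mathrm{span}\{x,\nabla f_i(x),\nabla f_i^*(x):x\in\mathcal H_i(k)\}$ for all $i$, where $f_i^*$ is the convex conjugate of $f_i$. (2) A communication round: $\mathcal H_i(k+1)\subseteq\mathrm{span}\big(\bigcup_{j\in\mathcal N_i^{q}\cup\{i\}}\mathcal H_j(k)\big)$ for all $i$, where this is the $q$-th communication round performed and $\mathcal N_i^{q}$ is the set of neighbors of $i$ in $\mathcal G_q$. An $\varepsilon$-accurate solution is a point $x$ (in the memory of some node) with $\|x-x_*\|^2\le\varepsilon$. The notation $\Omega(\cdot)$ is asymptotic as $\varepsilon\to0$ (for all sufficiently small $\varepsilon$), with a hidden positive constant depending only on $d$. *)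

(* Defs.v *)
From HB Require Import structures.
From mathcomp Require Import all_boot all_order all_algebra.
From mathcomp Require Import ring.
From mathcomp Require Import all_classical all_reals all_analysis.

Set Implicit Arguments.
Unset Strict Implicit.
Unset Printing Implicit Defensive.

Import Order.TTheory GRing.Theory Num.Theory.
Import numFieldNormedType.Exports.

Local Open Scope classical_set_scope.
Local Open Scope ring_scope.

Definition sqsum {R : realType} : {pred nat -> R} :=
  [pred u : nat -> R | `[< cvgn (series (fun i => u i ^+ 2)) >]].

Record ell2 (R : realType) := Ell2 {
  ell2_val :> nat -> R ;
  _ : ell2_val \in sqsum }.

Section ell2_theory.
Context {R : realType}.
Implicit Types (x y z : ell2 R) (u v : nat -> R).

Lemma is_cvg_series_mul u v :
  cvgn (series (fun i => u i ^+ 2)) -> cvgn (series (fun i => v i ^+ 2)) ->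
  cvgn (series (fun i => u i * v i)).
Proof.
move=> cu cv; apply: normed_cvg.
apply: (@series_le_cvg _ _ (fun i => u i ^+ 2 + v i ^+ 2)) => [n|n|n|].
- exact: normr_ge0.
- by rewrite addr_ge0 ?sqr_ge0.
- rewrite /= normrM -(real_normK (num_real (u n))) -(real_normK (num_real (v n))).
  have [uv|/ltW vu] := leP `|u n| `|v n|.
    by rewrite (le_trans (ler_wpM2r (normr_ge0 _) uv)) // -expr2 lerDr sqr_ge0.
  by rewrite (le_trans (ler_wpM2l (normr_ge0 _) vu)) // -expr2 lerDl sqr_ge0.
- exact: (is_cvg_seriesD cu cv).
Qed.

Lemma sqsum_submod_closed : submod_closed (@sqsum R).
Proof.
split=> [|a u v /asboolP cu /asboolP cv]; apply/asboolP.
  rewrite (_ : (fun _ => _) = (0 : R) *: (cst 0 : nat -> R)).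
    by apply: is_cvg_seriesZ; rewrite (_ : series _ = cst 0);
      [exact: is_cvg_cst | apply/funext => n; rewrite /series/= big1].
  by apply/funext => n; rewrite scale0r expr0n.
have cuv := is_cvg_series_mul cu cv.
rewrite (_ : (fun _ => _) = ((a ^+ 2) *: (fun i => u i ^+ 2) : nat -> R) +
   ((a *+ 2) *: (fun i => u i * v i) : nat -> R) + (fun i => v i ^+ 2)).
  by do 2?apply: is_cvg_seriesD => //; exact: is_cvg_seriesZ.
apply/funext => n.
rewrite -[RHS]/(a ^+ 2 * u n ^+ 2 + a *+ 2 * (u n * v n) + v n ^+ 2).
rewrite -[LHS]/((a * u n + v n) ^+ 2); ring.
Qed.

HB.instance Definition _ := [isSub for @ell2_val R].
HB.instance Definition _ := [Choice of ell2 R by <:].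
HB.instance Definition _ := GRing.isSubmodClosed.Build R (nat -> R) (@sqsum R)
  sqsum_submod_closed.
HB.instance Definition _ := [SubChoice_isSubLmodule of ell2 R by <:].

Definition dot x y : R := limn (series (fun i => x i * y i)).

Lemma is_cvg_dot x y : cvgn (series (fun i => x i * y i)).
Proof. by case: x y => u /= /asboolP ? [v /= /asboolP ?]; exact: is_cvg_series_mul. Qed.

Lemma dotC x y : dot x y = dot y x.
Proof.
by rewrite /dot; congr (limn (series _)); apply/funext => i; rewrite mulrC.
Qed.

Lemma dotDl x y z : dot (x + y) z = dot x z + dot y z.
Proof.
rewrite /dot -lim_seriesD; [|exact: is_cvg_dot..].
by congr (limn (series _)); apply/funext => i; rewrite -[LHS]/((x i + y i) * z i) mulrDl.
Qed.

Lemma dotZl a x z : dot (a *: x) z = a * dot x z.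
Proof.
rewrite /dot -[a * _]/(a *: _) -lim_seriesZ; last exact: is_cvg_dot.
by congr (limn (series _)); apply/funext => i; rewrite -[LHS]/((a * x i) * z i) -mulrA.
Qed.

Lemma le_coord_dot x i : x i ^+ 2 <= dot x x.
Proof.
apply: (@le_trans _ _ (series (fun i => x i * x i) i.+1)).
  rewrite /series/= big_nat_recr//= -expr2 lerDr sumr_ge0// => j _.
  by rewrite -expr2 sqr_ge0.
apply: nondecreasing_cvgn_le; last exact: is_cvg_dot.
by apply: nondecreasing_series => n _ _; rewrite -expr2 sqr_ge0.
Qed.

Lemma dot_ge0 x : 0 <= dot x x.
Proof. by rewrite (le_trans _ (le_coord_dot x 0%N)) ?sqr_ge0. Qed.

Lemma dot_eq0 x : dot x x = 0 -> x = 0.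
Proof.
move=> x0; apply/val_inj/funext => i /=; apply/eqP.
by rewrite -sqrf_eq0 eq_le sqr_ge0 -{1}x0 le_coord_dot.
Qed.

Lemma dot_sqrD x y : dot (x + y) (x + y) = dot x x + dot x y *+ 2 + dot y y.
Proof.
by rewrite dotDl !(dotC _ (x + y)) !dotDl (dotC y x) mulr2n !addrA.
Qed.

Lemma dot_CauchySchwarz x y : dot x y ^+ 2 <= dot x x * dot y y.
Proof.
have [y0|yN0] := eqVneq (dot y y) 0.
  by rewrite (dot_eq0 y0) dotC -(scale0r y) dotZl mul0r expr0n dotZl mul0r mulr0.
have ypos : 0 < dot y y by rewrite lt_neqAle eq_sym yN0 dot_ge0.
have := dot_ge0 (dot y y *: x + (- dot x y) *: y).
rewrite dot_sqrD !dotZl !(dotC _ (_ *: _)) !dotZl (dotC y x).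
set a := dot x x; set b := dot x y; set c := dot y y in ypos *.
rewrite (_ : _ + _ = c * (a * c - b ^+ 2)); last by ring.
by rewrite pmulr_rge0 // subr_ge0.
Qed.

Definition ell2_norm x : R := Num.sqrt (dot x x).

Lemma ell2_normD x y : ell2_norm (x + y) <= ell2_norm x + ell2_norm y.
Proof.
rewrite -(ger0_norm (addr_ge0 (sqrtr_ge0 _) (sqrtr_ge0 _))) -sqrtr_sqr.
rewrite ler_wsqrtr // dot_sqrD sqrrD !sqr_sqrtr ?dot_ge0 //.
rewrite lerD2r lerD2l lerMn2r /= -sqrtrM ?dot_ge0 //.
rewrite (le_trans (ler_norm _)) // -sqrtr_sqr.
by rewrite ler_wsqrtr // dot_CauchySchwarz.
Qed.

Lemma ell2_normZ a x : ell2_norm (a *: x) = `|a| * ell2_norm x.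
Proof.
rewrite /ell2_norm dotZl dotC dotZl mulrA -expr2.
by rewrite sqrtrM ?sqr_ge0 // sqrtr_sqr.
Qed.

Lemma ell2_norm_eq0 x : ell2_norm x = 0 -> x = 0.
Proof.
move=> /eqP; rewrite sqrtr_eq0 => x0.
by apply: dot_eq0; apply/le_anti; rewrite x0 dot_ge0.
Qed.

HB.instance Definition _ := Lmodule_isNormed.Build R (ell2 R)
  ell2_normD ell2_normZ ell2_norm_eq0.

Lemma ell2_normE x : `|x| = Num.sqrt (dot x x).
Proof. by []. Qed.

End ell2_theory.

Definition lspan (R : realType) (V : lmodType R) (A : set V) : set V :=
  [set v | exists (m : nat) (c : 'I_m -> R) (u : 'I_m -> V),
     (forall i, A (u i)) /\ v = \sum_(i < m) c i *: u i].

Section functions.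
Context {R : realType}.
Implicit Types (h : ell2 R -> R) (x y g : ell2 R).

Definition is_grad h x g : Prop := is_diff x h (dot g).

Definition smooth (L : R) h : Prop :=
  exists2 gh : ell2 R -> ell2 R, (forall x, is_grad h x (gh x)) &
    forall x y, `|gh y - gh x| <= L * `|y - x|.

Definition strongly_convex (mu : R) h : Prop :=
  exists2 gh : ell2 R -> ell2 R, (forall x, is_grad h x (gh x)) &
    forall x y, h x + dot (gh x) (y - x) + mu / 2 * `|y - x| ^+ 2 <= h y.

Definition conjugate h y : \bar R :=
  ereal_sup (range (fun x => (dot y x - h x)%:E)).

(* The conjugate may be infinite; it has a gradient only at points around
   which it is finite. *)
Definition is_conj_grad h y g : Prop :=
  (\forall z \near y, conjugate h z \is a fin_num) /\
  is_grad (fine \o conjugate h) y g.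

Definition minimizer h x : Prop := forall y, h x <= h y.

End functions.

Record graph (n : nat) := Graph {
  adj :> rel 'I_n ;
  adj_sym : symmetric adj ;
  adj_irr : irreflexive adj }.

Section graphs.
Context {n : nat}.
Implicit Types G : graph n.

Definition connected_graph G : Prop := forall i j, connect G i j.

Definition edges G : {set {set 'I_n}} :=
  [set [set p.1; p.2] | p : 'I_n * 'I_n & G p.1 p.2]%SET.

Definition degree G (i : 'I_n) : nat := #|G i|.

Definition laplacian (R : realType) G : 'M[R]_n :=
  diag_mx (\row_i (degree G i)%:R) - \matrix_(i, j) (G i j)%:R.

(* Finitely many eigenvalues, all of them real: the supremum is a maximum. The
   infimum is a minimum as soon as there is a nonzero eigenvalue, that is, for a
   connected graph with at least two vertices. *)
Definition lambda_max (R : realType) G : R :=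
  sup [set a | eigenvalue (laplacian R G) a].

Definition lambda_min_pos (R : realType) G : R :=
  inf [set a | eigenvalue (laplacian R G) a /\ a != 0].

Definition graph_chi (R : realType) G : R :=
  lambda_max R G / lambda_min_pos R G.

End graphs.

(* [pgraph k] is the network of the (k+1)-st communication round: round
   numbers start at 1, indices at 0. *)
Record problem (R : realType) := Problem {
  psize :> nat ;
  pgraph : nat -> graph psize ;
  plocal : 'I_psize -> ell2 R -> R ;
  pgraph_connected : forall k, connected_graph (pgraph k) ;
  plocal_convex : forall i, convex_function [set: ell2 R] (plocal i) ;
  plocal_smooth : forall i, exists M : R, smooth M (plocal i) }.

Section problems.
Context {R : realType}.
Implicit Types P : problem R.

Definition global P : ell2 R -> R :=
  fun x => P%:R^-1 * \sum_(i < P) plocal i x.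

(* The suprema below are over finite sets, since there are finitely many graphs
   on a given vertex set. *)
Definition chi P : R := sup (range (fun k => graph_chi R (pgraph P k))).

Definition Delta P : R :=
  sup (range (fun k => #|(edges (pgraph P k) :\: edges (pgraph P k.+1)) :|:
                         (edges (pgraph P k.+1) :\: edges (pgraph P k))|%:R)).

End problems.

Definition rounds (comm : nat -> bool) (k : nat) : nat := \sum_(t < k) comm t.

(* A run of an algorithm on P. The step from time k to time k+1 is a
   communication round if [acomm k], and a local computation otherwise. *)
Record algorithm (R : realType) (P : problem R) := Algorithm {
  acomm : nat -> bool ;
  amem : nat -> 'I_P -> set (ell2 R) ;
  amem0 : forall i, amem 0%N i = [set 0] ;
  amem_local : forall k, ~~ acomm k -> forall i,
    amem k.+1 i `<=` lspan
      [set y | exists2 x, amem k i x &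
         [\/ y = x, is_grad (plocal i) x y | is_conj_grad (plocal i) x y]] ;
  amem_comm : forall k, acomm k -> forall i,
    amem k.+1 i `<=` lspan
      (\bigcup_(j in [set j | (j == i) || pgraph P (rounds acomm k) i j])
         amem k j) }.

(* Main.v *)
(* A chain-structured quadratic is split over two far-apart nodes [a] and [b]:
   [a] couples coordinates (2k+1, 2k+2) and [b] couples (2k, 2k+1), so that the
   gradients of the local function and of its conjugate preserve "supported on
   the first m coordinates" at [a] for odd m and at [b] for even m, and at all
   other nodes for every m. Each further coordinate therefore costs one trip of
   M rounds between [a] and [b], whereas the minimizer is geometric, x_k = q^k
   with ln (1/q) <= 4 (mu/L)^(1/2), so that about (L/mu)^(1/2) ln (1/eps)
   coordinates are needed.

   It remains to find networks with chi <= C r^(d+1) and M >= r^d. For d = 1 a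
   static path does. For d >= 2 take two r-ary trees of depth d, containing [a]
   and [b] respectively, and r^d middle nodes m_k. At every round a single middle
   node m_s is joined to both trees, while m_k hangs from the k-th node of the
   left tree for k < s and of the right one for k > s.
   Moving s by one changes two edges; letting s follow the information makes the
   latter cross the middle nodes one at a time. Degrees are at most r + 2 and
   distances at most 4 (d + 1), so chi = O(r * r^d). *)
From HB Require Import structures.
Require Import Defs.
From mathcomp Require Import all_boot all_order all_algebra.
From mathcomp Require Import ring lra zify.
From mathcomp Require Import all_classical all_reals all_analysis.

Set Implicit Arguments.
Unset Strict Implicit.
Unset Printing Implicit Defensive.

Import Order.TTheory GRing.Theory Num.Theory.
Import numFieldNormedType.Exports.
Local Open Scope classical_set_scope.
Local Open Scope ring_scope.

(** * The space of square-summable sequences *)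

Section ell2_complements.
Context {R : realType}.
Implicit Types (x y z : ell2 R) (a : R).

Lemma dotDr x y z : dot x (y + z) = dot x y + dot x z.
Proof. by rewrite dotC dotDl !(dotC x). Qed.

Lemma dotZr a x y : dot x (a *: y) = a * dot x y.
Proof. by rewrite dotC dotZl dotC. Qed.

Lemma dotNl x y : dot (- x) y = - dot x y.
Proof. by rewrite -scaleN1r dotZl mulN1r. Qed.

Lemma dotNr x y : dot x (- y) = - dot x y.
Proof. by rewrite dotC dotNl dotC. Qed.

Definition dotE := (@dotDl R, dotDr, dotNl, dotNr, @dotZl R, dotZr).

Lemma ell2_sqnorm x : `|x| ^+ 2 = dot x x.
Proof. by rewrite ell2_normE sqr_sqrtr // dot_ge0. Qed.

Lemma dot_le_norm x y : `|dot x y| <= `|x| * `|y|.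
Proof.
rewrite -(@ler_pXn2r _ 2) ?nnegrE ?mulr_ge0 // exprMn !ell2_sqnorm.
by rewrite real_normK ?num_real // dot_CauchySchwarz.
Qed.

Lemma dot0r x : dot x 0 = 0.
Proof. by rewrite -(scale0r 0) dotZr mul0r. Qed.

Lemma ell2P x y : (forall i, x i = y i) -> x = y.
Proof. by move=> xy; apply/val_inj/funext. Qed.

Lemma ell2DE x y i : (x + y) i = x i + y i. Proof. by []. Qed.
Lemma ell2NE x i : (- x) i = - x i. Proof. by []. Qed.
Lemma ell2ZE a x i : (a *: x) i = a * x i. Proof. by []. Qed.
Lemma ell20E i : (0 : ell2 R) i = 0. Proof. by []. Qed.
Definition ell2E := (ell2DE, ell2NE, ell2ZE, ell20E).

Lemma sqsumP (u : nat -> R) :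
  reflect (cvgn (series (fun i => u i ^+ 2))) (u \in sqsum).
Proof. exact: asboolP. Qed.

Lemma sqsum_bounded (u : nat -> R) C :
  (forall n, series (fun i => u i ^+ 2) n <= C) -> u \in sqsum.
Proof.
move=> uC; apply/sqsumP; apply: nondecreasing_is_cvgn.
  by apply: nondecreasing_series => n _ _; rewrite sqr_ge0.
by exists C => _ [n _ <-].
Qed.

Lemma series_le_dot x n : series (fun i => x i ^+ 2) n <= dot x x.
Proof.
rewrite (_ : (fun _ => _) = fun i => x i * x i).
  apply: nondecreasing_cvgn_le; last exact: is_cvg_dot.
  by apply: nondecreasing_series => m _ _; rewrite -expr2 sqr_ge0.
by apply/funext => i; rewrite expr2.
Qed.

Lemma ell2_basis_subproof (k : nat) : (fun i => (i == k)%:R : R) \in sqsum.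
Proof.
apply: (@sqsum_bounded _ 1) => n; rewrite /series /=.
rewrite (eq_bigr (fun i => if i == k then 1 else 0)); last first.
  by move=> i _; case: eqP => _; rewrite ?expr1n ?expr0n.
by rewrite -big_mkcond /= big_nat1_eq; case: ifP.
Qed.

Definition ell2_basis k : ell2 R := Ell2 (ell2_basis_subproof k).

Lemma ell2_basisE k i : ell2_basis k i = (i == k)%:R. Proof. by []. Qed.

End ell2_complements.

(** * Exchange of neighbouring coordinates *)

Section neighbour_swap.

(* Exchanges [i] and [i + 1] whenever [i] has the parity of [e]; if [e] is odd,
   [0] has no partner and is fixed. *)
Definition swap_nbr (e : bool) (i : nat) : nat :=
  if odd i == e then i.+1 else i.-1.

Lemma swap_nbrK e : involutive (swap_nbr e).
Proof.
move=> [|i]; rewrite /swap_nbr; first by case: e.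
by rewrite oddS; case: e; case o: (odd i) => //=; rewrite ?oddS ?o //=;
  case: i o => //= i; case: odd.
Qed.

(** The tail from [m] on is stable because [m] does not separate a swapped pair. This parity
    condition is what slows every algorithm down. *)
Lemma swap_nbr_ge (e : bool) m i : (m == 0%N) || (odd m == e) ->
  (m <= i)%N -> (m <= swap_nbr e i)%N.
Proof.
rewrite /swap_nbr => me mi; case: eqP => [_|ie]; first exact: leqW.
have [mi'|] := ltnP m i; first by rewrite -ltnS (ltn_predK mi').
move=> im; have {mi im} E : i = m by lia.
by case/orP: me => [/eqP->//|/eqP]; rewrite -E.
Qed.

(** The initial segment of length [k.*2 + e] consists of whole pairs, plus the fixed point 0 when
    [e] is odd, so the exchange only permutes it. *)
Lemma sum_swap_nbr (V : zmodType) (F : nat -> V) (e : bool) k :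
  \sum_(0 <= i < k.*2 + e) F (swap_nbr e i) = \sum_(0 <= i < k.*2 + e) F i.
Proof.
elim: k => [|k IH].
  by case: e; rewrite ?big_nil // !big_nat1 /swap_nbr /=.
rewrite doubleS !addSn !big_nat_recr //= -!addrA IH; congr (_ + _).
have ok : odd (k.*2 + e) = e by rewrite oddD odd_double addFb oddb.
have nok : (~~ e == e) = false by case: (e).
by rewrite addrC /swap_nbr /= ok nok eqxx.
Qed.

Context {R : realType}.
Implicit Types (x y : ell2 R).

Lemma swap_subproof (e : bool) x : (x \o swap_nbr e) \in sqsum.
Proof.
apply: (@sqsum_bounded _ _ (dot x x)) => n.
apply: le_trans (series_le_dot x (n.*2 + e)).
rewrite /series /= -(sum_swap_nbr (fun i => x i ^+ 2)).
rewrite [X in _ <= X](@big_cat_nat _ _ _ n) //=; last by rewrite -addnn; lia.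
by rewrite lerDl sumr_ge0 // => i _; rewrite sqr_ge0.
Qed.

Definition swap (e : bool) x : ell2 R := Ell2 (swap_subproof e x).

Lemma swapE e x i : swap e x i = x (swap_nbr e i). Proof. by []. Qed.

Lemma swapK e : involutive (swap e).
Proof. by move=> x; apply/ell2P => i; rewrite !swapE swap_nbrK. Qed.

Lemma swapD e x y : swap e (x + y) = swap e x + swap e y.
Proof. exact/ell2P. Qed.

Lemma swapN e x : swap e (- x) = - swap e x.
Proof. exact/ell2P. Qed.

Lemma swapZ e a x : swap e (a *: x) = a *: swap e x.
Proof. exact/ell2P. Qed.

(** The partial sums of the two series agree at the lengths [k.*2 + e], where no pair is cut; both
    limits can be read off along this subsequence. *)
Lemma dot_swap e x y : dot (swap e x) y = dot x (swap e y).
Proof.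
set u := series (fun i => swap e x i * y i).
set v := series (fun i => x i * swap e y i).
have uv : u \o (fun k => k.*2 + e)%N = v \o (fun k => k.*2 + e)%N.
  apply/funext => k; rewrite /u /v /series /=.
  rewrite -(sum_swap_nbr (fun i => x i * y (swap_nbr e i))).
  by apply: eq_bigr => i _; rewrite swap_nbrK.
have oo : (fun k => k.*2 + e)%N @ \oo --> \oo.
  by apply/cvgnyPge => A; near=> k; rewrite (@leq_trans k) //;
    [near: k; exact: nbhs_infty_ge | rewrite -addnn -addnA leq_addr].
have cu : u @ \oo --> dot (swap e x) y by exact: is_cvg_dot.
have cv : v @ \oo --> dot x (swap e y) by exact: is_cvg_dot.
have /(cvg_lim (@Rhausdorff R)) <- := cvg_comp _ _ oo cu.
by rewrite uv; apply/(cvg_lim (@Rhausdorff R)); exact: cvg_comp oo cv.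
Unshelve. all: by end_near. Qed.

Lemma norm_swap e x : `|swap e x| = `|x|.
Proof. by rewrite !ell2_normE dot_swap swapK. Qed.

End neighbour_swap.

(** * Gradients and quadratic local functions *)

Section gradients.
Context {R : realType}.
Implicit Types (h : ell2 R -> R) (x y g : ell2 R).

Lemma continuous_dot g : continuous (dot g : ell2 R -> R).
Proof.
move=> x; apply/(@cvgrPdist_le _ _ _ (nbhs x) (nbhs_filter x)) => e e0.
have ng : 0 < `|g| + 1 by rewrite ltr_wpDl.
apply/nbhs_normP; exists (e / (`|g| + 1)); first exact: divr_gt0.
move=> y /= xy; rewrite -[dot g x - _]/(dot g x + - _) -dotNr -dotDr.
rewrite (le_trans (dot_le_norm _ _)) // (@le_trans _ _ ((`|g| + 1) * `|x - y|)) //.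
  by rewrite ler_wpM2r // lerDl.
by rewrite -ler_pdivlMl // mulrC ltW.
Qed.

Fact dot_linear g : linear (dot g : ell2 R -> R).
Proof. by move=> a x y; rewrite dotDr dotZr. Qed.

HB.instance Definition _ g :=
  GRing.isLinear.Build R (ell2 R) R _ (dot g) (dot_linear g).

Lemma is_gradP h x g : is_grad h x g <->
  forall e : R, 0 < e -> exists2 r : R, 0 < r &
    forall v, `|v| < r -> `|h (x + v) - h x - dot g v| <= e * `|v|.
Proof.
have nearP (P : set (ell2 R)) :
    (\forall v \near 0, P v) <-> exists2 r : R, 0 < r & forall v, `|v| < r -> P v.
  split=> [/nbhs_normP[r r0 rP]|[r r0 rP]].
    by exists r => // v vr; apply: rP; rewrite /= sub0r normrN.
  by apply/nbhs_normP; exists r => // v; rewrite /= sub0r normrN => /rP.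
have expand : h \o shift x = (cst (h x) + dot g : ell2 R -> R) +o_ (0 : ell2 R) id <->
    forall e : R, 0 < e -> exists2 r : R, 0 < r &
    forall v, `|v| < r -> `|h (x + v) - h x - dot g v| <= e * `|v|.
  rewrite eqaddoP; split=> H e e0; have := H e e0.
    move=> /nearP[r r0 rP]; exists r => // v /rP.
    by rewrite /= !fctE /= [v + x]addrC opprD addrA.
  case=> r r0 rP; apply/nearP; exists r => // v /rP.
  by rewrite /= !fctE /= [v + x]addrC opprD addrA.
rewrite -expand; split=> [[dh dE]|E].
  by have := diff_locally dh; rewrite dE.
have dE : 'd h x = dot g :> (ell2 R -> R).
  by apply: diff_unique => //; exact: continuous_dot.
split => //; apply/diff_locallyP; rewrite dE; split=> //.
exact: continuous_dot.
Qed.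

Lemma grad_unique h x g g' : is_grad h x g -> is_grad h x g' -> g = g'.
Proof.
move=> [_ dg] [_ dg']; apply/eqP; rewrite -subr_eq0; apply/eqP/dot_eq0.
have E := congr1 (@^~ (g - g')) (etrans (esym dg) dg').
by rewrite dotDl dotNl E subrr.
Qed.

(** For [w = g - g'], a small move along [- w] makes [h] decrease at a rate close to [dot g w],
    while the minorant allows only the rate [dot g' w]; the gap of the two rates is the squared norm
    of [w]. *)
Lemma grad_of_local_minorant h x g g' : is_grad h x g ->
  (\forall z \near x, h x + dot g' (z - x) <= h z) -> g = g'.
Proof.
move=> /is_gradP gh /nbhs_normP[r /= r0 rP].
apply/eqP; rewrite -subr_eq0 -normr_eq0; apply/negP => /negP w0.
set w := g - g' in w0 *.
have wp : 0 < `|w| by rewrite normr_gt0 -normr_eq0.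
have [|s /= s0 sP] := gh (`|w| / 2); first by rewrite divr_gt0.
(* This scale gives [- t *: w] the length [Num.min r s / 2], inside both neighbourhoods. *)
set t := Num.min r s / (2 * `|w|).
have t0 : 0 < t by rewrite divr_gt0 ?lt_min ?r0 ?s0 // mulr_gt0.
have tw : `|- t *: w| = Num.min r s / 2.
  by rewrite normrZ normrN gtr0_norm // /t; field; rewrite gt_eqF.
have min0 : 0 < Num.min r s by rewrite lt_min r0.
have tr : `|- t *: w| < r.
  by rewrite tw ltr_pdivrMr // (@le_lt_trans _ _ r) ?ge_min ?lexx // ltr_pMr // ltr1n.
have ts : `|- t *: w| < s.
  by rewrite tw ltr_pdivrMr // (@le_lt_trans _ _ s) ?ge_min ?lexx ?orbT // ltr_pMr // ltr1n.
have lo := rP (x + - t *: w); rewrite /ball_ /= in lo.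
rewrite opprD !addrA (addrAC x (- t *: w)) subrr !add0r normrN dotZr in lo.
have {}lo := lo tr.
have := le_trans (ler_norm _) (sP _ ts).
rewrite normrZ normrN gtr0_norm // dotZr => hi.
have dw : dot g w - dot g' w = `|w| ^+ 2 by rewrite ell2_sqnorm /w dotDl dotNl.
have : t * `|w| ^+ 2 <= t * `|w| ^+ 2 / 2 by rewrite -[in leLHS]dw; lra.
by rewrite leNgt => /negP; apply; rewrite ltr_pdivrMr // ltr_pMr ?ltr1n // mulr_gt0 // exprn_gt0.
Qed.

Lemma grad_of_quadratic_remainder h x g (K : R) : 0 <= K ->
  (forall v, `|h (x + v) - h x - dot g v| <= K * `|v| ^+ 2) -> is_grad h x g.
Proof.
move=> K0 HK; apply/is_gradP => e e0; exists (e / (K + 1)).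
  by rewrite divr_gt0 // ltr_wpDl.
move=> v vr; rewrite (le_trans (HK v)) // expr2 mulrA ler_wpM2r //.
rewrite (@le_trans _ _ ((K + 1) * `|v|)) // ?ler_wpM2r ?lerDl //.
by rewrite -ler_pdivlMl ?ltr_wpDl // mulrC ltW.
Qed.

(** The subgradient inequalities at the convex combination [p], weighted by [t] and [1 - t], add up
    to convexity, since the linear terms cancel. *)
Lemma convex_of_subgradients h (gh : ell2 R -> ell2 R) :
  (forall x y, h x + dot (gh x) (y - x) <= h y) ->
  convex_function [set: ell2 R] h.
Proof.
move=> sub t x y _ _; set p := conv t x y.
have tn : 0 <= t%:num by [].
have t1 : 0 <= 1 - t%:num :> R by rewrite subr_ge0.
have pE : p = t%:num *: (x : ell2 R) + (1 - t%:num) *: (y : ell2 R) by [].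
have -> : conv t (h x : R^o) (h y : R^o) = t%:num * h x + (1 - t%:num) * h y by [].
have := lerD (ler_wpM2l tn (sub p x)) (ler_wpM2l t1 (sub p y)).
apply: le_trans; rewrite le_eqVlt; apply/orP; left; apply/eqP.
rewrite !dotDr !dotNr [in dot _ (p : ell2 R)]pE dotDr !dotZr; ring.
Qed.

(** Fenchel duality: [z] maps to [dot z g0 - h g0], an affine minorant of the conjugate with slope
    [g0], and the subgradient hypothesis makes it touch the conjugate at [y]. Finiteness near [y]
    lets [fine] be compared with it. *)
Lemma conj_grad_of_subgradient h y g g0 :
  (forall x, h g0 + dot y (x - g0) <= h x) -> is_conj_grad h y g -> g = g0.
Proof.
move=> sub [finy gy]; apply: (grad_of_local_minorant gy).
have cy : fine (conjugate h y) <= dot y g0 - h g0.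
  have : (conjugate h y <= (dot y g0 - h g0)%:E)%E.
    apply: ge_ereal_sup => _ [x _ <-]; rewrite lee_fin.
    by have := sub x; rewrite dotDr dotNr; lra.
  by rewrite -[in leLHS](fineK (nbhs_singleton finy)) lee_fin.
apply: filterS finy => z finz.
have cz : dot z g0 - h g0 <= fine (conjugate h z).
  by rewrite -lee_fin fineK //; apply: ereal_sup_ubound; exists g0.
rewrite /= dotDr dotNr (dotC _ z) (dotC _ y); lra.
Qed.

End gradients.

(** * Quadratics coupling swapped pairs *)

Section local_functions.
Context {R : realType}.
Implicit Types (mu al b : R) (e : bool) (x y v : ell2 R).

(** The difference [dot x x - dot x (swap e x)] is the sum of the squares of [x i - x j] over the
    swapped pairs, so [al] is the strength of the coupling and [b] that of the source at coordinate
    0. *)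
Definition pair_quad mu al e b x : R :=
  mu / 2 * dot x x + al / 2 * (dot x x - dot x (swap e x))
  - b * dot (ell2_basis 0) x.

Definition pair_quad_grad mu al e b x : ell2 R :=
  mu *: x + al *: (x - swap e x) - b *: ell2_basis 0.

(** With S the involution [swap e], the inverse of (mu + al) I - al S is (mu + al) I + al S divided
    by (mu + al)^2 - al^2 = mu (mu + 2 al). *)
Definition pair_quad_grad_inv mu al e b y : ell2 R :=
  let w := y + b *: ell2_basis 0 in
  (mu * (mu + 2 * al))^-1 *: ((mu + al) *: w + al *: swap e w).

Lemma pair_quadD mu al e b x v :
  pair_quad mu al e b (x + v) =
  pair_quad mu al e b x + dot (pair_quad_grad mu al e b x) v
  + (mu / 2 * dot v v + al / 2 * (dot v v - dot v (swap e v))).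
Proof.
rewrite /pair_quad /pair_quad_grad !swapD !dotE (dotC v x) (dotC v (swap e x)).
by rewrite (dot_swap e x v); field.
Qed.

Lemma dot_swap_le e (v : ell2 R) : `|dot v (swap e v)| <= dot v v.
Proof.
by rewrite (le_trans (dot_le_norm _ _)) // norm_swap -expr2 ell2_sqnorm.
Qed.

Lemma pair_quad_is_grad mu al e b x : 0 <= mu -> 0 <= al ->
  is_grad (pair_quad mu al e b) x (pair_quad_grad mu al e b x).
Proof.
move=> mu0 al0; apply: (@grad_of_quadratic_remainder _ _ _ _ (mu / 2 + al)) => [|v].
  by rewrite addr_ge0 // divr_ge0.
rewrite pair_quadD ell2_sqnorm; have := dot_swap_le e v; have := dot_ge0 v.
set d := dot v v; set s := dot v _ => d0 sd.
rewrite (_ : _ - _ - _ = mu / 2 * d + al / 2 * (d - s)); last by ring.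
have ds : 0 <= d - s <= 2 * d by move: sd; rewrite ler_norml; lra.
rewrite ger0_norm; last by rewrite addr_ge0 ?mulr_ge0 ?divr_ge0 //; lra.
have : al / 2 * (d - s) <= al / 2 * (2 * d) by rewrite ler_wpM2l ?divr_ge0 //; lra.
lra.
Qed.

Lemma pair_quad_strong mu al e b x y : 0 <= al ->
  pair_quad mu al e b x + dot (pair_quad_grad mu al e b x) (y - x)
  + mu / 2 * `|y - x| ^+ 2 <= pair_quad mu al e b y.
Proof.
move=> al0; rewrite -[in leRHS](subrKC x y) pair_quadD ell2_sqnorm addrA lerDl.
rewrite mulr_ge0 ?divr_ge0 // subr_ge0 (le_trans (ler_norm _)) //.
exact: dot_swap_le.
Qed.

Lemma pair_quad_subgrad mu al e b x y : 0 <= mu -> 0 <= al ->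
  pair_quad mu al e b x + dot (pair_quad_grad mu al e b x) (y - x)
    <= pair_quad mu al e b y.
Proof.
move=> mu0 al0; apply: le_trans (pair_quad_strong mu e b x y al0).
by rewrite lerDl mulr_ge0 ?divr_ge0 ?sqr_ge0.
Qed.

Lemma pair_quad_gradB mu al e b x y :
  pair_quad_grad mu al e b y - pair_quad_grad mu al e b x =
  mu *: (y - x) + al *: (y - x - swap e (y - x)).
Proof.
by apply/ell2P => i; rewrite /pair_quad_grad swapD swapN !ell2E; ring.
Qed.

Lemma norm_pair_quad_gradB mu al e b x y : 0 <= mu -> 0 <= al ->
  `|pair_quad_grad mu al e b y - pair_quad_grad mu al e b x| <=
  (mu + 2 * al) * `|y - x|.
Proof.
move=> mu0 al0; rewrite pair_quad_gradB (le_trans (ler_normD _ _)) // mulrDl.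
rewrite !normrZ !ger0_norm // lerD2l [2 * _]mulrC -mulrA ler_wpM2l //.
by rewrite (le_trans (ler_normB _ _)) // norm_swap mulr_natl.
Qed.

Lemma pair_quad_smooth mu al e b : 0 <= mu -> 0 <= al ->
  smooth (mu + 2 * al) (pair_quad mu al e b).
Proof.
move=> mu0 al0; exists (pair_quad_grad mu al e b) => [x|x y].
  exact: pair_quad_is_grad.
exact: norm_pair_quad_gradB.
Qed.

Lemma pair_quad_convex mu al e b : 0 <= mu -> 0 <= al ->
  convex_function [set: ell2 R] (pair_quad mu al e b).
Proof.
by move=> mu0 al0; apply: convex_of_subgradients => x y; exact: pair_quad_subgrad.
Qed.

Lemma pair_quad_grad_invK mu al e b : 0 < mu -> 0 <= al ->
  cancel (pair_quad_grad_inv mu al e b) (pair_quad_grad mu al e b).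
Proof.
move=> mu0 al0 y; have d0 : mu + 2 * al != 0.
  by rewrite gt_eqF // ltr_wpDr // mulr_ge0.
apply/ell2P => i; rewrite /pair_quad_grad /pair_quad_grad_inv.
rewrite !(swapD, swapZ) !swapK !ell2E.
by field; rewrite d0 gt_eqF.
Qed.

Lemma pair_quad_conj_grad mu al e b y g : 0 < mu -> 0 <= al ->
  is_conj_grad (pair_quad mu al e b) y g -> g = pair_quad_grad_inv mu al e b y.
Proof.
move=> mu0 al0; apply: conj_grad_of_subgradient => x.
rewrite -[X in dot X](pair_quad_grad_invK e b mu0 al0).
by apply: pair_quad_subgrad => //; exact: ltW.
Qed.

Definition supp_below (m : nat) : set (ell2 R) :=
  [set x | forall i, (m <= i)%N -> x i = 0].

Lemma supp_belowW m m' : (m <= m')%N -> supp_below m `<=` supp_below m'.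
Proof. by move=> mm' x xm i m'i; exact/xm/(leq_trans mm'). Qed.

Lemma supp_below_lin m (a : R) x y :
  supp_below m x -> supp_below m y -> supp_below m (a *: x + y).
Proof. by move=> xm ym i mi; rewrite !ell2E xm // ym // mulr0 addr0. Qed.

Lemma supp_below0 m : supp_below m 0.
Proof. by []. Qed.

Lemma supp_belowZ m a x : supp_below m x -> supp_below m (a *: x).
Proof. by move=> xm; rewrite -[_ *: _]addr0; apply: supp_below_lin. Qed.

Lemma supp_belowD m x y :
  supp_below m x -> supp_below m y -> supp_below m (x + y).
Proof. by move=> xm; rewrite -[x]scale1r; exact: supp_below_lin. Qed.

Lemma supp_below_swap m e x : (m == 0%N) || (odd m == e) ->
  supp_below m x -> supp_below m (swap e x).
Proof. by move=> me xm i mi; apply: xm; exact: swap_nbr_ge. Qed.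

Lemma supp_below_basis m : (0 < m)%N -> supp_below m (ell2_basis 0).
Proof. by move=> m0 i mi; rewrite ell2_basisE gtn_eqF // (leq_trans m0). Qed.

Lemma lspan_supp_below m (A : set (ell2 R)) :
  A `<=` supp_below m -> lspan A `<=` supp_below m.
Proof.
move=> Am _ [k [c [u [uA ->]]]].
elim/big_ind: _ => [|x y|i _]; [exact: supp_below0 | exact: supp_belowD |].
exact/supp_belowZ/Am/uA.
Qed.

(** Both gradients are combinations of [x], [swap e] and [ell2_basis 0]. The support survives if an
    active coupling does not have a pair cut by [m] and an active source lies below [m]. *)
Lemma pair_quad_local_supp mu al e b m x y : 0 < mu -> 0 <= al ->
  (al == 0) || (m == 0%N) || (odd m == e) -> (b == 0) || (0 < m)%N ->
  supp_below m x ->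
  [\/ y = x, is_grad (pair_quad mu al e b) x y
    | is_conj_grad (pair_quad mu al e b) x y] -> supp_below m y.
Proof.
move=> mu0 al0 ame bm xm.
have bs : supp_below m (b *: ell2_basis 0).
  by case/orP: bm => [/eqP->|/supp_below_basis /supp_belowZ//]; rewrite scale0r.
have sw z : supp_below m z -> supp_below m (al *: swap e z).
  case/orP: ame => [/orP[/eqP->|m0]|me] zm; first by rewrite scale0r.
    by apply: supp_belowZ; apply: supp_below_swap => //; rewrite m0.
  by apply: supp_belowZ; apply: supp_below_swap => //; rewrite me orbT.
case=> [->//|xy|/(pair_quad_conj_grad mu0 al0)->].
  rewrite (grad_unique xy (pair_quad_is_grad _ _ _ (ltW mu0) al0)).
  rewrite /pair_quad_grad scalerBr -!scaleNr.
  do !apply: supp_belowD; rewrite ?scaleNr; do ?exact: supp_belowZ.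
    by rewrite -scaleN1r; apply: supp_belowZ; exact: sw.
  by rewrite -scaleN1r; exact: supp_belowZ.
have wm := supp_belowD xm bs.
by apply: supp_belowZ; apply: supp_belowD; [exact: supp_belowZ|exact: sw].
Qed.

End local_functions.

(** * The chain problem on a relay network *)

(* Round before which a node in position [p] knows only points supported on the
   first [m] coordinates: coordinate [m] (counted from 0) can only be produced
   at position 0 if [m] is even and at position [M] if [m] is odd, and [M] more
   rounds are needed to cross the network. *)
Definition arrival (M m p : nat) : nat :=
  (m * M + (if odd m then M - p else p))%N.

(** [relay_arrival] is the only fact about the edges that limits the spread of information.
    Positions may jump along an edge as long as the timing given by [arrival] is respected. *)
Record relay_network (n M : nat) (G : nat -> graph n) (pos : 'I_n -> nat)
    (a b : 'I_n) : Prop := RelayNetwork {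
  relay_connected : forall q, connected_graph (G q) ;
  relay_gt0 : (0 < M)%N ;
  relay_left : pos a = 0%N ;
  relay_right : pos b = M ;
  relay_arrival : forall q m i j, G q i j ->
    (arrival M m (pos j) <= q)%N -> (arrival M m (pos i) <= q.+1)%N }.

Section chain_problem.
Context {R : realType} (mu beta b0 : R) {mu_gt0 : 0 < mu} {beta_ge0 : 0 <= beta}.
Context {n M : nat} {G : nat -> graph n} {pos : 'I_n -> nat} {a b : 'I_n}.
Context (net : relay_network M G pos a b).

(** The factor [n%:R], here and on the source, cancels the averaging in [global], so the global
    function does not depend on the network. *)
Definition chain_al (i : 'I_n) : R := if (i == a) || (i == b) then n%:R * beta else 0.

Definition chain_local (i : 'I_n) : ell2 R -> R :=
  pair_quad mu (chain_al i) (i == a) (if i == a then n%:R * b0 else 0).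

Lemma chain_al_ge0 i : 0 <= chain_al i.
Proof. by rewrite /chain_al; case: ifP => // _; rewrite mulr_ge0. Qed.

Fact chain_local_convex i : convex_function [set: ell2 R] (chain_local i).
Proof. exact: pair_quad_convex (ltW mu_gt0) (chain_al_ge0 i). Qed.

Fact chain_local_smooth i : exists K : R, smooth K (chain_local i).
Proof.
by eexists; exact: pair_quad_smooth (ltW mu_gt0) (chain_al_ge0 i).
Qed.

Definition chain_problem : problem R :=
  Problem (relay_connected net) chain_local_convex chain_local_smooth.

Lemma chain_ends_neq : a != b.
Proof.
apply/eqP => ab; have := relay_gt0 net.
by rewrite -(relay_right net) -ab (relay_left net).
Qed.

Lemma chain_size_gt0 : (0 < n)%N.
Proof. exact: leq_trans (ltn_ord a). Qed.

Lemma chain_globalE x : global chain_problem x =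
  pair_quad mu beta true b0 x + pair_quad 0 beta false 0 x.
Proof.
have n0 : n%:R != 0 :> R by rewrite pnatr_eq0 -lt0n chain_size_gt0.
rewrite /global /=.
set U := mu / 2 * dot x x.
set V := beta / 2 * (dot x x - dot x (swap true x)) - b0 * dot (ell2_basis 0) x.
set W := beta / 2 * (dot x x - dot x (swap false x)).
have sum1 (c : 'I_n) (F : R) : \sum_(i < n) (if i == c then F else 0) = F.
  by rewrite -big_mkcond big_pred1_eq.
rewrite (eq_bigr (fun i => U + (if i == a then n%:R * V else 0)
    + (if i == b then n%:R * W else 0))); last first.
  move=> i _; rewrite /chain_local /chain_al /pair_quad /U /V /W.
  have [->|ia] := eqVneq i a; first by rewrite (negbTE chain_ends_neq) /=; ring.
  by case: (i == b) => /=; ring.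
rewrite !big_split /= !sum1 sumr_const card_ord -[U *+ n]mulr_natl.
rewrite -!mulrDr mulrA mulVf // mul1r /pair_quad /U /V /W; ring.
Qed.

Definition chain_grad (x : ell2 R) : ell2 R :=
  pair_quad_grad mu beta true b0 x + pair_quad_grad 0 beta false 0 x.

Lemma chain_is_grad x : is_grad (global chain_problem) x (chain_grad x).
Proof.
have -> : global chain_problem =
    pair_quad mu beta true b0 + pair_quad 0 beta false 0.
  by apply/funext => y; rewrite chain_globalE.
have g1 := pair_quad_is_grad true b0 x (ltW mu_gt0) beta_ge0.
have g2 := pair_quad_is_grad false 0 x (lexx 0) beta_ge0.
apply: is_diff_eq (is_diffD g1 g2) _.
by apply/funext => v; rewrite /chain_grad dotDl.
Qed.

Lemma chain_smooth L : mu + 4 * beta = L -> smooth L (global chain_problem).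
Proof.
move=> <-; exists chain_grad => [|x y]; first exact: chain_is_grad.
rewrite /chain_grad opprD addrACA (le_trans (ler_normD _ _)) //.
have := norm_pair_quad_gradB true b0 x y (ltW mu_gt0) beta_ge0.
have := norm_pair_quad_gradB false 0 x y (lexx 0) beta_ge0.
move: `|_| `|_| `|_| => *; lra.
Qed.

Lemma chain_strongly_convex : strongly_convex mu (global chain_problem).
Proof.
exists chain_grad => [|x y]; first exact: chain_is_grad.
rewrite !chain_globalE /chain_grad dotDl.
have := pair_quad_strong mu true b0 x y beta_ge0.
have := pair_quad_subgrad false 0 x y (lexx 0) beta_ge0.
move: (pair_quad mu _ _ _ x) (pair_quad mu _ _ _ y) (pair_quad 0 _ _ _ x)
  (pair_quad 0 _ _ _ y) (dot _ _) (dot _ _) (_ * `|_| ^+ 2) => *; lra.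
Qed.

Lemma chain_minimizer x : chain_grad x = 0 -> minimizer (global chain_problem) x.
Proof.
move=> gx y; rewrite !chain_globalE.
have := pair_quad_subgrad true b0 x y (ltW mu_gt0) beta_ge0.
have := pair_quad_subgrad false 0 x y (lexx 0) beta_ge0.
have : dot (chain_grad x) (y - x) = 0 by rewrite gx dotC dot0r.
rewrite /chain_grad dotDl.
move: (pair_quad mu _ _ _ x) (pair_quad mu _ _ _ y) (pair_quad 0 _ _ _ x)
  (pair_quad 0 _ _ _ y) (dot _ _) (dot _ _) => *; lra.
Qed.

(** Induction on time: communication rounds are controlled by the contrapositive of [relay_arrival],
    local computations by the parity of [m]. *)
Lemma chain_memory_supp (A : algorithm chain_problem) k i x m :
  amem A k i x -> (rounds (acomm A) k < arrival M m (pos i))%N ->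
  supp_below m x.
Proof.
elim: k i x m => [|k IH] i x m.
  by rewrite amem0 => ->.
have [ck|nck] := boolP (acomm A k).
  have -> : rounds (acomm A) k.+1 = (rounds (acomm A) k).+1.
    by rewrite /rounds big_ord_recr /= ck addn1.
  move=> /(amem_comm ck) xA qm; apply: lspan_supp_below xA => y [j /= ij yj].
  apply: (IH _ _ _ yj); case/orP: ij => [/eqP->|ij]; first exact: ltnW.
  by rewrite ltnNge; apply/negP => /(relay_arrival net ij); rewrite leqNgt qm.
have -> : rounds (acomm A) k.+1 = rounds (acomm A) k.
  by rewrite /rounds big_ord_recr /= (negbTE nck) addn0.
move=> /(amem_local nck) xA qm.
(* If [m] has the wrong parity at [a] or [b], then [arrival] takes the same value there for the
   predecessor of [m], so the stronger support bound is already available and fits the local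
   coupling. *)
suff [m' [m'm qm' alm' bm']] : exists m', [/\ (m' <= m)%N,
    (rounds (acomm A) k < arrival M m' (pos i))%N,
    (chain_al i == 0) || (m' == 0%N) || (odd m' == (i == a))
    & ((if i == a then n%:R * b0 else 0) == 0) || (0 < m')%N].
  apply: (supp_belowW m'm); apply: lspan_supp_below xA => z [y yk yz].
  exact: (pair_quad_local_supp mu_gt0 (chain_al_ge0 i) alm' bm' (IH _ _ _ yk qm') yz).
have [ia|ia] := eqVneq i a.
  move: qm; rewrite ia (relay_left net) /arrival.
  have [om|em] := boolP (odd m) => qm.
    by exists m; split; rewrite ?om ?eqxx ?odd_gt0 ?orbT.
  case: m em qm => // m em qm; exists m; move: em; rewrite oddS negbK => om.
  split; rewrite ?leqnSn ?om ?eqxx ?odd_gt0 ?orbT //.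
  by move: qm; rewrite subn0 addn0 mulSn addnC.
rewrite eqxx; have [ib|ib] := eqVneq i b; last first.
  by exists m; rewrite /chain_al (negbTE ia) (negbTE ib) /= eqxx.
move: qm; rewrite ib (relay_right net) /arrival.
have [om|em] := boolP (odd m) => qm; last first.
  by exists m; split; rewrite ?(negbTE em) ?eqxx ?orbT.
case: m om qm => // m om qm; exists m; move: om; rewrite oddS => om.
split; rewrite ?leqnSn ?(negbTE om) ?eqxx ?orbT //.
by move: qm; rewrite subnn addn0 mulSn addnC.
Qed.

(** With fewer than [m * M] rounds every memory vanishes at coordinate [m], whatever the position;
    the error there is at least the minimizer's own coordinate. *)
Lemma chain_rounds (A : algorithm chain_problem) k i x (xs : ell2 R) :
  amem A k i x ->
  xs ((rounds (acomm A) k %/ M).+1) ^+ 2 <= `|x - xs| ^+ 2.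
Proof.
move=> xA; set m := (_ %/ M).+1.
have xm : supp_below m x.
  apply: (chain_memory_supp xA); apply: leq_trans (leq_addr _ _).
  exact: ltn_ceil (relay_gt0 net).
rewrite ell2_sqnorm (le_trans _ (le_coord_dot _ m)) //.
by rewrite !ell2E xm // sub0r sqrrN.
Qed.

End chain_problem.

(** * The geometric minimizer and the bound on the rounds *)

Section geometric.
Context {R : realType} (q : R) {q01 : 0 < q < 1}.

Fact geometric_subproof : (fun k => q ^+ k) \in (@sqsum R).
Proof.
case/andP: q01 => q0 q1; apply: (@sqsum_bounded _ _ (1 - q ^+ 2)^-1) => k.
have Q1 : 0 < 1 - q ^+ 2 by rewrite subr_gt0 exprn_ilt1 // ltW.
rewrite -[leRHS]mul1r ler_pdivlMr // /series /= big_mkord mulrC.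
rewrite (eq_bigr (fun i : 'I_k => (q ^+ 2) ^+ i)); last first.
  by move=> i _; rewrite -!exprM mulnC.
rewrite -opprB mulNr -subrX1 opprB lerBlDr lerDl -exprM exprn_ge0 // ltW //.
Qed.

Definition geometric_ell2 : ell2 R := Ell2 geometric_subproof.

(** The hypothesis is the characteristic equation of the three-term recurrence satisfied by the
    minimizer; the source strength is chosen to satisfy row 0. *)
Lemma chain_grad_geometric (mu beta : R) : beta * (1 - q) ^+ 2 = mu * q ->
  chain_grad mu beta (beta * (1 - q) + mu) geometric_ell2 = 0.
Proof.
move=> bq; apply/ell2P => k.
rewrite /chain_grad /pair_quad_grad !ell2E !swapE /swap_nbr.
rewrite -[geometric_ell2 k]/(q ^+ k) ell2_basisE.
set x := geometric_ell2.
(* At [k = 0] the truncated predecessor [k.-1 = 0] matches the fixed point of [swap true], so one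
   formula covers all rows. *)
have -> : mu * q ^+ k + beta * (q ^+ k - x (if odd k == true then k.+1 else k.-1)) -
  (beta * (1 - q) + mu) * (k == 0%N)%:R +
  (0 * q ^+ k + beta * (q ^+ k - x (if odd k == false then k.+1 else k.-1)) -
   0 * (k == 0%N)%:R) = (mu + 2 * beta) * q ^+ k - beta * (q ^+ k.+1 + q ^+ k.-1)
   - (beta * (1 - q) + mu) * (k == 0%N)%:R.
  have xE j : x j = q ^+ j by [].
  by rewrite !xE; case: (odd k) => /=; ring.
case: k => [|k] /=; first by rewrite expr0 expr1; ring.
transitivity (q ^+ k * (mu * q - beta * (1 - q) ^+ 2)); first by rewrite !exprS; ring.
by rewrite bq subrr mulr0.
Qed.

End geometric.

Lemma powR_frac_le (R : realType) (C x r : R) (d : nat) :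
  1 <= C -> 0 <= r -> 0 <= x -> x <= C * r ^+ d.+1 ->
  x `^ (d%:R / d.+1%:R) <= C * r ^+ d.
Proof.
move=> C1 r0 x0 xle; have C0 : 0 <= C by exact: le_trans C1.
have e0 : 0 <= d%:R / d.+1%:R :> R by rewrite divr_ge0.
apply: (@le_trans _ _ ((C * r ^+ d.+1) `^ (d%:R / d.+1%:R))).
  by rewrite ge0_ler_powR // nnegrE // mulr_ge0 // exprn_ge0.
rewrite powRM ?exprn_ge0 //; apply: ler_pM; rewrite ?powR_ge0 //.
  rewrite -[leRHS]powRr1 // ler_powR //.
  by rewrite ler_pdivrMr // mul1r ler_nat.
rewrite -powR_mulrn // -powRrM mulrC divfK ?pnatr_eq0 //.
by rewrite powR_mulrn.
Qed.

(** Reduces the theorem to networks: crossing time at least [r ^ d] against a condition number of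
    order [r ^ d.+1]. *)
Lemma relay_network_bound (R : realType) (d : nat) (C L mu : R) (B n M r : nat)
    (G : nat -> graph n) (pos : 'I_n -> nat) (a b : 'I_n) :
  1 <= C -> 0 < mu -> 24 * mu < L -> relay_network M G pos a b ->
  (B < n)%N -> (r ^ d <= M)%N ->
  (forall k, graph_chi R (G k) <= C * r%:R ^+ d.+1) ->
  (exists k, B%:R < graph_chi R (G k)) ->
  (forall k, #|(edges (G k) :\: edges (G k.+1)) :|:
               (edges (G k.+1) :\: edges (G k))| <= 12 * (d - 1))%N ->
  exists (P : problem R) (xs : ell2 R),
    [/\ smooth L (global P), strongly_convex mu (global P),
        B%:R < chi P, (B < P)%N & Delta P <= (12 * (d - 1))%:R] /\
    minimizer (global P) xs /\
    exists eps0 : R, 0 < eps0 /\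
    forall eps : R, 0 < eps < eps0 ->
    forall (A : algorithm P) (k : nat) (i : 'I_P) (x : ell2 R),
      amem A k i x -> `|x - xs| ^+ 2 <= eps ->
      (16 * C)^-1 * (chi P `^ (d%:R / d.+1%:R) * Num.sqrt (L / mu) * ln (1 / eps))
        <= (rounds (acomm A) k)%:R.
Proof.
move=> C1 mu0 muL net Bn rM chi_le [k0 chi_gt] dE.
set s := Num.sqrt (L / mu).
have L0 : 0 < L by lra.
have s2 : s ^+ 2 = L / mu by rewrite sqr_sqrtr // divr_ge0 // ltW.
have Ls : L = mu * s ^+ 2 by rewrite s2 mulrC divfK // gt_eqF.
have s4 : 4 < s.
  rewrite -(@ltr_pXn2r _ 2) ?nnegrE ?sqrtr_ge0 // s2 ltr_pdivlMr //; lra.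
(* The root in (0, 1) of [beta * (1 - q) ^+ 2 = mu * q], where [beta] is fixed by
   [mu + 4 * beta = L]. *)
pose q := (s - 1) / (s + 1).
pose beta := (L - mu) / 4.
have beta0 : 0 <= beta by rewrite /beta; lra.
have q0 : 0 < q by rewrite divr_gt0 //; lra.
have q1 : q < 1 by rewrite ltr_pdivrMr; lra.
have q01 : 0 < q < 1 by rewrite q0.
have bq : beta * (1 - q) ^+ 2 = mu * q.
  by rewrite /beta /q Ls; field; lra.
(* The logarithm is at most 2 / (s - 1), which is at most 4 / s because [s] exceeds 2. *)
have lq : - ln q <= 4 / s.
  have -> : - ln q = ln (1 + 2 / (s - 1)).
    by rewrite -lnV ?posrE // /q; congr ln; field; lra.
  have s1 : 0 < s - 1 by lra.
  apply: le_trans (le_ln1Dx _) _; first by rewrite (@lt_trans _ _ 0) ?divr_gt0 //.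
  by rewrite ler_pdivrMr // mulrAC ler_pdivlMr; lra.
have lq0 : 0 < - ln q by rewrite oppr_gt0 ln_lt0 // q0.
pose P : problem R := @chain_problem R mu beta (beta * (1 - q) + mu) mu0 beta0
  n M G pos a b net.
have PE : chi P = sup (range (fun k => graph_chi R (G k))) by [].
have ub : has_ubound (range (fun k => graph_chi R (G k))).
  by exists (C * r%:R ^+ d.+1) => _ [k _ <-].
have chiB : B%:R < chi P.
  by rewrite PE; apply: lt_le_trans chi_gt _; apply: ub_le_sup => //; exists k0.
have chiC : chi P <= C * r%:R ^+ d.+1.
  rewrite PE; apply: ge_sup; first by exists (graph_chi R (G 0%N)), 0%N.
  by move=> _ [k _ <-].
have chi0 : 0 <= chi P by rewrite ltW // (le_lt_trans _ chiB).
exists P, (geometric_ell2 (q01 := q01)); split.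
  split => //.
  - by apply: chain_smooth => //; rewrite /beta; field.
  - exact: chain_strongly_convex.
  - apply: ge_sup; first by eexists; exists 0%N.
    by move=> _ [k _ <-]; rewrite ler_nat; exact: dE.
split; first by apply: chain_minimizer => //; exact: chain_grad_geometric.
(* Below [q ^+ 4], half of [- ln eps] is at least [2 * - ln q]; this absorbs the extra 1 in
   [2 * (m%:R + 1) * - ln q]. *)
exists (q ^+ 4); split; first exact: exprn_gt0.
move=> eps /andP[eps0 epsq] A k i x xA xeps.
have M0 := relay_gt0 net.
set Q := rounds _ _; set m := (Q %/ M)%N.
have epsm : (q ^+ m.+1) ^+ 2 <= eps.
  by apply: le_trans xeps; exact: (chain_rounds (geometric_ell2 (q01 := q01)) xA).
have leps : - ln eps <= 2 * (m%:R + 1) * - ln q.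
  have : ln ((q ^+ m.+1) ^+ 2) <= ln eps by rewrite ler_ln // posrE ?exprn_gt0.
  rewrite -exprM lnXn // -[_ *+ (_ * _)]mulr_natr natrM -addn1 natrD; lra.
have lepsq : 4 * - ln q <= - ln eps.
  have : ln eps <= ln (q ^+ 4) by rewrite ler_ln ?posrE ?exprn_gt0 // ltW.
  by rewrite lnXn // -[_ *+ _]mulr_natr; lra.
have s0 : 0 < s by lra.
have mQ : m%:R * M%:R <= Q%:R :> R by rewrite -natrM ler_nat leq_trunc_div.
have lepsm : s * - ln eps <= 16 * m%:R.
  have h : - ln eps <= 4 * m%:R * - ln q by lra.
  rewrite (le_trans (ler_wpM2l (ltW s0) h)) //.
  rewrite (le_trans (ler_wpM2l (ltW s0) (ler_wpM2l _ lq))) ?mulr_ge0 //.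
  by rewrite le_eqVlt; apply/orP; left; apply/eqP; field; lra.
have chiM : chi P `^ (d%:R / d.+1%:R) <= C * M%:R.
  apply: (le_trans (powR_frac_le C1 _ chi0 chiC)) => //.
  by rewrite ler_wpM2l ?(le_trans _ C1) // -natrX ler_nat.
have C0 : 0 < C by exact: lt_le_trans C1.
rewrite div1r lnV ?posrE // -mulrA ler_pdivrMl ?mulr_gt0 //.
apply: (@le_trans _ _ (C * M%:R * (16 * m%:R))).
  apply: ler_pM => //; rewrite ?powR_ge0 //.
  by rewrite mulr_ge0 ?ltW // (lt_le_trans _ lepsq) // mulr_gt0.
rewrite (_ : _ * _ = 16 * C * (m%:R * M%:R)); last by ring.
by rewrite ler_wpM2l // mulr_ge0 // ltW.
Qed.

(** * Laplacian spectrum of a graph *)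

Section walks.
Context {T : finType} (e : rel T).

Definition dist_le (D : nat) (x y : T) : Prop :=
  exists p, [/\ path e x p, last x p = y & (size p <= D)%N].

Lemma dist_le0 x : dist_le 0 x x.
Proof. by exists [::]. Qed.

Lemma dist_le1 x y : e x y -> dist_le 1 x y.
Proof. by move=> xy; exists [:: y]; rewrite /= xy. Qed.

Lemma dist_le_leq D D' x y : (D <= D')%N -> dist_le D x y -> dist_le D' x y.
Proof. by move=> DD [p [pp pl ps]]; exists p; split=> //; exact: leq_trans DD. Qed.

Lemma dist_le_trans D D' x y z :
  dist_le D x y -> dist_le D' y z -> dist_le (D + D') x z.
Proof.
move=> [p [pp pl ps]] [q [qp ql qs]]; exists (p ++ q).
by rewrite cat_path last_cat pl pp size_cat leq_add.
Qed.

Lemma dist_le_sym D x y : symmetric e -> dist_le D x y -> dist_le D y x.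
Proof.
move=> es [p [pp <- ps]]; exists (rev (belast x p)); split.
- by rewrite rev_path (eq_path (e' := e)) // => u v; rewrite es.
- by case: p pp ps => //= y' p _ _; rewrite rev_cons last_rcons.
- by rewrite size_rev size_belast.
Qed.

Lemma dist_le_connect D x y : dist_le D x y -> connect e x y.
Proof. by move=> [p [pp <- _]]; apply/connectP; exists p. Qed.

Context {R : realType} (v : T -> R).

Fixpoint path_energy (x : T) (p : seq T) : R :=
  if p is y :: p' then (v x - v y) ^+ 2 + path_energy y p' else 0.

Lemma path_energy_ge0 x p : 0 <= path_energy x p.
Proof. by elim: p x => //= y p IH x; rewrite addr_ge0 ?sqr_ge0. Qed.

(** Cauchy-Schwarz for the telescoping sum of the differences along the path. *)
Lemma path_energy_ends x p :
  (v x - v (last x p)) ^+ 2 <= (size p)%:R * path_energy x p.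
Proof.
elim: p x => [|y p IH] x /=; first by rewrite subrr expr0n mul0r.
have := IH y; set b := v y - v _; set S := path_energy y p => bS.
rewrite (_ : v x - v _ = (v x - v y) + b); last by rewrite /b; ring.
set a := v x - v y; rewrite -natr1.
case: (posnP (size p)) bS => [->|p0 bS].
  rewrite mul0r add0r mul1r => b0.
  have /eqP : b ^+ 2 = 0 by apply/eqP; rewrite eq_le b0 sqr_ge0.
  by rewrite sqrf_eq0 => /eqP ->; rewrite addr0 lerDl path_energy_ge0.
set k : R := (size p)%:R in bS *; have k0 : 0 < k by rewrite ltr0n.
rewrite -(ler_pM2l k0) -subr_ge0.
have -> : k * ((k + 1) * (a ^+ 2 + S)) - k * (a + b) ^+ 2 =
  (k * a - b) ^+ 2 + (k + 1) * (k * S - b ^+ 2) by ring.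
by rewrite addr_ge0 ?sqr_ge0 // mulr_ge0 ?subr_ge0 // addr_ge0 // ltW.
Qed.

(** Each step is charged to the vertex it leaves; these vertices are distinct. *)
Lemma path_energy_le x p : path e x p -> uniq (x :: p) ->
  path_energy x p <= \sum_i \sum_j (e i j)%:R * (v i - v j) ^+ 2.
Proof.
move=> ep up; pose F i := \sum_j (e i j)%:R * (v i - v j) ^+ 2.
have F0 i : 0 <= F i.
  by apply: sumr_ge0 => j _; rewrite mulr_ge0 ?sqr_ge0.
have : path_energy x p <= \sum_(i <- x :: p) F i.
  elim: p x ep {up} => [|y p IH] x /=; first by rewrite big_seq1.
  move=> /andP[xy yp]; rewrite big_cons lerD ?IH // /F (bigD1 y) //= xy mul1r.
  by rewrite lerDl; apply: sumr_ge0 => j _; rewrite mulr_ge0 ?sqr_ge0.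
move=> /le_trans; apply; rewrite big_uniq //=.
rewrite [leRHS](bigID (mem (x :: p))) /= lerDl.
by apply: sumr_ge0 => i _; exact: F0.
Qed.

Lemma dist_le_energy D x y : dist_le D x y ->
  (v x - v y) ^+ 2 <= D%:R * \sum_i \sum_j (e i j)%:R * (v i - v j) ^+ 2.
Proof.
move=> [p [+ <- pD]]; case/shortenP => q eq uq sq.
have qD : (size q <= D)%N by rewrite (leq_trans _ pD) // uniq_leq_size //; case/andP: uq.
rewrite (le_trans (path_energy_ends x q)) // ler_pM ?ler_nat ?path_energy_ge0 //.
exact: path_energy_le.
Qed.

End walks.

Section laplacian_spectrum.
Context {R : realType} {n : nat} (G : graph n).

Lemma degreeE i : (degree G i)%:R = \sum_j (G i j)%:R :> R.
Proof.
by rewrite -natr_sum /degree -sum1_card big_mkcond /=; congr (_%:R).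
Qed.

Lemma laplacian_eigenP (c : R) :
  eigenvalue (laplacian R G) c <->
  exists v : 'I_n -> R, (exists i, v i != 0) /\
    forall i, \sum_j (G i j)%:R * (v i - v j) = c * v i.
Proof.
have lapE (v : 'rV[R]_n) i :
    (v *m laplacian R G) 0 i = \sum_j (G i j)%:R * (v 0 i - v 0 j).
  rewrite /laplacian mulmxBr !mxE; under [RHS]eq_bigr do rewrite mulrBr.
  rewrite big_split /= sumrN -mulr_suml -degreeE; congr (_ - _).
    rewrite (bigD1 i) //= big1 => [|j ji]; first by rewrite !mxE eqxx mulr1n addr0 mulrC.
    by rewrite !mxE (negbTE ji) mulr0n mulr0.
  by apply: eq_bigr => j _; rewrite !mxE adj_sym mulrC.
split.
  move=> /eigenvalueP[v vE v0]; exists (fun i => v 0 i); split.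
    by apply/existsP; apply: contra_neqT v0 => /existsPn h; apply/rowP => i;
      rewrite mxE; apply/eqP; rewrite -[_ == _]negbK h.
  by move=> i; rewrite -lapE vE mxE.
move=> [v [[i vi] vE]]; apply/eigenvalueP; exists (\row_i v i).
  apply/rowP => j; rewrite lapE !mxE -vE.
  by apply: eq_bigr => k _; rewrite !mxE.
by apply: contra_neq vi => /rowP/(_ i); rewrite !mxE.
Qed.

(** Gershgorin's argument: the eigenvalue equation is read at a vertex where the eigenvector is
    largest in absolute value. *)
Lemma laplacian_eigen_le (c : R) (dg : nat) :
  (forall i, degree G i <= dg)%N -> eigenvalue (laplacian R G) c ->
  c <= 2 * dg%:R.
Proof.
move=> degG /laplacian_eigenP[v [[i0 vi0] vE]].
pose i := [arg max_(i > i0) `|v i|]%O.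
have imax j : `|v j| <= `|v i| by rewrite /i; case: arg_maxP => // k _; apply.
have vi : 0 < `|v i| by rewrite (lt_le_trans _ (imax i0)) ?normr_gt0.
rewrite -(ler_pM2r vi) (@le_trans _ _ `|c * v i|) //.
  by rewrite normrM ler_wpM2r // ler_norm.
rewrite -vE (le_trans (ler_norm_sum _ _ _)) //.
apply: (@le_trans _ _ (\sum_j (G i j)%:R * (2 * `|v i|))).
  apply: ler_sum => j _; rewrite normrM normr_nat ler_wpM2l //.
  by rewrite (le_trans (ler_normB _ _)) // mulr_natl mulr2n lerD2l.
by rewrite -mulr_suml -degreeE mulrCA mulrA ler_wpM2r // ler_wpM2l // ler_nat.
Qed.

(** For a nonzero eigenvalue the eigenvector has sum 0, so its largest entry [v i] faces some [v j]
    of opposite sign or zero. A path from [i] to [j] then gives v_i^2 <= D E, where the energy E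
    equals 2 c times the sum of squares, hence is at most 2 c n v_i^2. *)
Lemma laplacian_eigen_ge (c : R) (D : nat) :
  (forall i j, dist_le G D i j) -> eigenvalue (laplacian R G) c -> c != 0 ->
  1 <= c * (2 * n%:R * D%:R).
Proof.
move=> GD /laplacian_eigenP[v [[i0 vi0] vE]] c0.
pose i := [arg max_(i > i0) `|v i|]%O.
have imax j : `|v j| <= `|v i| by rewrite /i; case: arg_maxP => // k _; apply.
have vi : 0 < `|v i| by rewrite (lt_le_trans _ (imax i0)) ?normr_gt0.
have Gsw (F : 'I_n -> 'I_n -> R) :
    \sum_i \sum_j (G i j)%:R * F i j = \sum_i \sum_j (G i j)%:R * F j i.
  rewrite exchange_big; apply: eq_bigr => x _; apply: eq_bigr => y _.
  by rewrite adj_sym.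
have csum (F : 'I_n -> R) : c * \sum_i F i * v i =
    \sum_i \sum_j (G i j)%:R * (F i * (v i - v j)).
  rewrite mulr_sumr; apply: eq_bigr => x _; rewrite mulrCA -vE mulr_sumr.
  by apply: eq_bigr => y _; rewrite mulrCA.
have v_sum0 : \sum_j v j = 0.
  have h : c * (\sum_j 1 * v j) = - (c * (\sum_j 1 * v j)).
    rewrite csum {1}Gsw -sumrN; apply: eq_bigr => x _.
    by rewrite -sumrN; apply: eq_bigr => y _; ring.
  have /eqP : c * (\sum_j 1 * v j) = 0 by lra.
  rewrite mulf_eq0 (negbTE c0) /= => /eqP v0; rewrite -[RHS]v0.
  by apply: eq_bigr => j _; rewrite mul1r.
have [j vij] : exists j, v j * v i <= 0.
  apply: contrapT => /forallNP vpos.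
  have vpos' j : 0 < v j * v i by rewrite ltNge; apply/negP/vpos.
  have : 0 < \sum_j v j * v i.
    by rewrite (bigD1 i) //= ltr_pwDl // sumr_ge0 // => j _; exact: ltW.
  by rewrite -mulr_suml v_sum0 mul0r ltxx.
pose E := \sum_i \sum_j (G i j)%:R * (v i - v j) ^+ 2.
pose S := \sum_i v i * v i.
have ES : E = 2 * (c * S).
  rewrite mulr_natl mulr2n [in X in _ + X]csum Gsw csum -big_split /=.
  apply: eq_bigr => x _; rewrite -big_split /=.
  by apply: eq_bigr => y _; ring.
have E0 : 0 <= E.
  by apply: sumr_ge0 => x _; apply: sumr_ge0 => y _; rewrite mulr_ge0 ?sqr_ge0.
have vi2 : 0 < v i ^+ 2 by rewrite exprn_even_gt0 // -normr_gt0.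
have S0 : 0 < S.
  rewrite /S (bigD1 i) //= -expr2 ltr_pwDl // sumr_ge0 // => k _.
  by rewrite -expr2 sqr_ge0.
have Sn : S <= n%:R * v i ^+ 2.
  rewrite (@le_trans _ _ (\sum_(k < n) v i ^+ 2)) //; last first.
    by rewrite sumr_const card_ord mulr_natl.
  apply: ler_sum => k _; rewrite -expr2 -[v k ^+ 2]real_normK ?num_real //.
  by rewrite -[v i ^+ 2]real_normK ?num_real // ler_pXn2r ?nnegrE.
have c_ge0 : 0 <= c.
  by move: E0; rewrite ES pmulr_rge0 // pmulr_lge0.
have key : v i ^+ 2 <= D%:R * E.
  apply: le_trans (dist_le_energy v (GD i j)).
  rewrite -subr_ge0 (_ : _ - _ = v j ^+ 2 - 2 * (v j * v i)); last by ring.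
  by rewrite subr_ge0 (le_trans _ (sqr_ge0 _)) // mulr_ge0_le0.
rewrite -(ler_pM2r vi2) mul1r (le_trans key) //.
rewrite ES (_ : _ * (2 * _) = c * (2 * D%:R) * S); last by ring.
rewrite (_ : c * (2 * n%:R * D%:R) * _ = c * (2 * D%:R) * (n%:R * v i ^+ 2)); last by ring.
by rewrite ler_wpM2l // !mulr_ge0.
Qed.

Lemma graph_chi_le (dg D : nat) :
  (forall i, degree G i <= dg)%N -> (forall i j, dist_le G D i j) ->
  graph_chi R G <= 4 * dg%:R * n%:R * D%:R.
Proof.
move=> degG GD; pose b : R := (2 * n%:R * D%:R).
have b0 : 0 <= b by rewrite !mulr_ge0.
have lmax : lambda_max R G <= 2 * dg%:R.
  rewrite /lambda_max; set A := [set _ | _].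
  have [->|/set0P A0] := eqVneq A set0; first by rewrite sup0 mulr_ge0.
  by apply: ge_sup => // c; exact: laplacian_eigen_le.
(* Without a nonzero eigenvalue [lambda_min_pos] is the infimum of the empty set, which is 0, and so
   is the quotient by it. *)
have lmin : lambda_min_pos R G = 0 \/ 1 <= lambda_min_pos R G * b.
  rewrite /lambda_min_pos; set A := [set _ | _].
  have [->|/set0P A0] := eqVneq A set0; first by left; rewrite inf0.
  right; have [c [cG c0]] := A0.
  have := laplacian_eigen_ge GD cG c0; rewrite -/b => cb.
  have bp : 0 < b.
    by rewrite lt_neqAle b0 andbT; apply/eqP => bE; move: cb; rewrite -bE mulr0 ler10.
  rewrite -ler_pdivrMr //; apply: lb_le_inf => // x [xG x0].
  by rewrite ler_pdivrMr //; exact: laplacian_eigen_ge.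
rewrite /graph_chi (_ : 4 * _ * _ * _ = 2 * dg%:R * b); last by rewrite /b; ring.
case: lmin => [->|lmin]; first by rewrite invr0 mulr0 !mulr_ge0.
have lp : 0 < lambda_min_pos R G.
  by rewrite ltNge; apply/negP => l0; move: (mulr_le0_ge0 l0 b0); lra.
rewrite ler_pdivrMr // (le_trans lmax) // -[leRHS]mulrA ler_peMr ?mulr_ge0 //.
by rewrite mulrC.
Qed.

(** The degree bound and the spectral gap make the supremum and the infimum genuine bounds, so any
    two eigenvalues can be compared with them. *)
Lemma graph_chi_ge (D : nat) (c1 c2 : R) :
  (forall i j, dist_le G D i j) ->
  0 <= c1 -> eigenvalue (laplacian R G) c1 ->
  c2 != 0 -> eigenvalue (laplacian R G) c2 -> c1 / c2 <= graph_chi R G.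
Proof.
move=> GD c1_ge0 c1G c20 c2G; pose b : R := (2 * n%:R * D%:R).
have b0 : 0 <= b by rewrite !mulr_ge0.
have bp : 0 < b.
  have := laplacian_eigen_ge GD c2G c20; rewrite -/b => cb.
  by rewrite lt_neqAle b0 andbT; apply/eqP => bE; move: cb; rewrite -bE mulr0 ler10.
have lb c : eigenvalue (laplacian R G) c /\ c != 0 -> b^-1 <= c.
  by move=> [cG c0]; rewrite -div1r ler_pdivrMr //; exact: laplacian_eigen_ge.
have lmax : c1 <= lambda_max R G.
  apply: ub_le_sup => //; exists (2 * n%:R) => c; apply: laplacian_eigen_le => i.
  by rewrite (leq_trans (max_card _)) // card_ord.
have lminp : 0 < lambda_min_pos R G.
  apply: (@lt_le_trans _ _ b^-1); first by rewrite invr_gt0.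
  by apply: lb_le_inf; [exists c2 | exact: lb].
have lmin : lambda_min_pos R G <= c2.
  by apply: ge_inf => //; exists b^-1 => c; exact: lb.
have c2p : 0 < c2 by exact: lt_le_trans lmin.
rewrite /graph_chi ler_pdivrMr // -mulrA (le_trans lmax) //.
rewrite ler_peMr ?(le_trans c1_ge0) // mulrC ler_pdivlMr // mul1r.
exact: lmin.
Qed.

End laplacian_spectrum.

(** * The static path *)

Section path_graph.
Context (n : nat).

Definition path_adj : rel 'I_n := fun i j => (i.+1 == j) || (j.+1 == i).

Fact path_adj_sym : symmetric path_adj.
Proof. by move=> i j; rewrite /path_adj orbC. Qed.

Fact path_adj_irr : irreflexive path_adj.
Proof. by move=> i; rewrite /path_adj orbb; apply/eqP; lia. Qed.

Definition path_graph : graph n := Graph path_adj_sym path_adj_irr.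

Lemma path_graph_dist i j : dist_le path_graph n.-1 i j.
Proof.
wlog ij : i j / (i <= j)%N.
  by move=> h; case/orP: (leq_total i j) => /h// ; apply/dist_le_sym/path_adj_sym.
suff : dist_le path_graph (j - i) i j.
  by apply: dist_le_leq; have := ltn_ord j; lia.
move: j ij => [j jn] /=; elim: j jn => [|j IH] jn ij.
  by rewrite sub0n (_ : Ordinal jn = i); [exact: dist_le0 | apply: ord_inj => /=; lia].
have [ij'|ji] := leqP i j.
  rewrite subSn // -addn1; apply: dist_le_trans (IH (ltnW jn) ij') _.
  by apply: dist_le1; rewrite /= /path_adj /= eqxx.
have -> : Ordinal jn = i by apply: ord_inj => /=; lia.
exact: dist_le_leq (dist_le0 _ _).
Qed.

Lemma path_graph_connected : connected_graph path_graph.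
Proof. by move=> i j; exact: dist_le_connect (path_graph_dist i j). Qed.

Lemma path_graph_laplacian (R : realType) (w : nat -> R) (i : 'I_n) :
  \sum_j (path_graph i j)%:R * (w i - w j) =
  (if (i.+1 < n)%N then w i - w i.+1 else 0)
  + (if (0 < i)%N then w i - w i.-1 else 0).
Proof.
have pick1 k (F : nat -> R) :
    \sum_(j < n) (j == k :> nat)%:R * F j = if (k < n)%N then F k else 0.
  rewrite -(big_mkord xpredT (fun j => (j == k)%:R * F j)).
  rewrite -[RHS](@big_nat1_eq _ _ +%R F k 0) big_mkcond; apply: eq_bigr => j _.
  by case: eqP => _; rewrite ?mul1r ?mul0r.
rewrite -(pick1 i.+1 (fun j => w i - w j)).
have -> : (if (0 < i)%N then w i - w i.-1 else 0) =
    \sum_(j < n) (j.+1 == i :> nat)%:R * (w i - w j).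
  case: (i) => [[|k] kn] /=; first by rewrite big1 // => j _; rewrite mul0r.
  by rewrite (pick1 k (fun j => w k.+1 - w j)) ltnW.
rewrite -big_split /=; apply: eq_bigr => j _.
rewrite -mulrDl -natrD /path_adj [i.+1 == j]eq_sym.
by congr (_%:R * _); do 2 case: eqP => //=; lia.
Qed.

Lemma path_graph_degree i : (degree path_graph i <= 2)%N.
Proof.
rewrite /degree cardE -(size_map val).
have : {subset map val (enum (path_adj i)) <= [:: i.+1; i.-1]}.
  move=> k /mapP[j + ->]; rewrite mem_enum unfold_in => ij.
  by rewrite !inE /=; case/orP: ij => /eqP; lia.
by apply: uniq_leq_size; rewrite map_inj_uniq ?enum_uniq //; exact: val_inj.
Qed.

(** The eigenvector is a cosine sampled at half-integers. Its reflection symmetry at the left end is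
    the evenness of cosine, and at the right end it is the condition on the sine; [cos h] is its
    first entry. *)
Lemma path_graph_eigenvalue (R : realType) (h : R) :
  (0 < n)%N -> sin (n%:R * (2 * h)) = 0 -> cos h != 0 ->
  eigenvalue (laplacian R path_graph) (2 - 2 * cos (2 * h)).
Proof.
move=> n0 sinh cosh; apply/laplacian_eigenP.
pose w (k : nat) : R := cos ((2 * k%:R + 1) * h).
exists (fun i => w i); split.
  by exists (Ordinal n0); rewrite /w /= mulr0 add0r mul1r.
move=> i; rewrite path_graph_laplacian.
have cosDB (x y : R) : cos (x + y) + cos (x - y) = 2 * (cos y * cos x).
  by rewrite cosB cosD; ring.
have -> : (if (i.+1 < n)%N then w i - w i.+1 else 0) = w i - w i.+1.
  case: ltnP => // ni; have nE : n%:R = i%:R + 1 :> R.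
    by rewrite natr1; congr (_%:R); have := ltn_ord i; lia.
  have -> : w i = cos (n%:R * (2 * h) - h).
    by rewrite /w nE; congr cos; ring.
  have -> : w i.+1 = cos (n%:R * (2 * h) + h).
    by rewrite /w nE -natr1; congr cos; ring.
  by rewrite cosB cosD sinh; ring.
have E : 2 * (cos (2 * h) * w i) = w i.+1 + cos ((2 * (i%:R : R) + 1) * h - 2 * h).
  by rewrite -cosDB /w; congr (_ + _); rewrite -?natr1; congr cos; ring.
have -> : (if (0 < i)%N then w i - w i.-1 else 0)
    = w i - cos ((2 * (i%:R : R) + 1) * h - 2 * h).
  case: (i : nat) => [|k] /=; last first.
    by rewrite /w -natr1; congr (_ - cos _); ring.
  by rewrite /w -[X in _ - X]cosN; apply/esym/eqP; rewrite subr_eq0; apply/eqP; congr cos; ring.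
rewrite mulrBl -mulrA E; ring.
Qed.

End path_graph.

Lemma path_relay_network (M : nat) : (0 < M)%N ->
  relay_network M (fun=> path_graph M.+1) (fun i => i) ord0 ord_max.
Proof.
move=> M0; split => //; first by move=> _; exact: path_graph_connected.
move=> q m i j; rewrite /= /path_adj /arrival => /orP ij.
by have := ltn_ord i; have := ltn_ord j; case: odd; case: ij => /eqP; lia.
Qed.

Lemma cos_pi_div_near1 (R : realType) (e : R) : 0 < e ->
  exists n0 : nat, forall n, (n0 <= n)%N -> 1 - e < cos (pi / n.+1%:R).
Proof.
move=> e0; have := @continuous_cos R 0.
rewrite /continuous_at cos0 => /cvgrPdist_lt/(_ e e0)/nbhs_normP[r /= r0 rP].
exists (Num.bound (pi / r)) => n nr.
have pn : 0 < pi / n.+1%:R :> R by rewrite divr_gt0 // pi_gt0.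
have pr : 0 <= pi / r by rewrite divr_ge0 ?pi_ge0 // ltW.
suff : `|1 - cos (pi / n.+1%:R)| < e by move=> /ltr_normlW; rewrite ltrBlDr -ltrBlDl.
apply: rP; rewrite /= sub0r normrN gtr0_norm // ltr_pdivrMr // mulrC -ltr_pdivrMr //.
by rewrite (lt_le_trans (archi_boundP pr)) // ler_nat leqW.
Qed.

Lemma path_graph_chi_le (R : realType) (M : nat) : (0 < M)%N ->
  graph_chi R (path_graph M.+1) <= 16 * M%:R ^+ 2.
Proof.
move=> M0; apply: le_trans (graph_chi_le (@path_graph_degree _) (@path_graph_dist _)) _.
have M1 : 1 <= M%:R :> R by rewrite ler1n.
rewrite -natr1 /=; have : M%:R * 1 <= M%:R * M%:R :> R by rewrite ler_wpM2l.
rewrite expr2; lra.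
Qed.

(** With [t] the cosine of pi / (M + 1), both 2 - 2 t and 2 + 2 t are eigenvalues, and their ratio
    is unbounded as [t] tends to 1. *)
Lemma path_graph_chi_gt (R : realType) (B : nat) :
  exists n0 : nat, forall M, (n0 <= M)%N -> B%:R < graph_chi R (path_graph M.+1).
Proof.
have e0 : 0 < (B.+1%:R)^-1 :> R by rewrite invr_gt0.
have [n0 n0P] := cos_pi_div_near1 e0; exists n0.+1 => M n0M.
have := n0P M (ltnW n0M); set t := cos _ => te.
have N0 : M.+1%:R != 0 :> R by rewrite pnatr_eq0.
have N2 : 2 <= M.+1%:R :> R by rewrite ler_nat ltnS (leq_trans _ n0M).
pose h : R := pi / (2 * M.+1%:R).
have h0 : 0 < h by rewrite divr_gt0 ?pi_gt0 // mulr_gt0.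
have h2 : h < pi / 2.
  rewrite /h invfM mulrA ltr_pdivrMr // ltr_pMr ?divr_gt0 ?pi_gt0 //.
  by rewrite (lt_le_trans _ N2) // ltr1n.
have tE : t = cos (2 * h) by rewrite /t /h; congr cos; field.
have t1 : t < 1.
  rewrite -cos0 tE ltr_cos ?in_itv /= ?lexx ?pi_ge0 //; first by rewrite mulr_gt0.
  by rewrite mulr_ge0 ?(ltW h0) //=; lra.
have eig1 : eigenvalue (laplacian R (path_graph M.+1)) (2 - 2 * t).
  rewrite tE; apply: path_graph_eigenvalue => //.
    by rewrite (_ : _ * _ = pi) ?sinpi // /h; field.
  by rewrite gt_eqF // cos_gt0_pihalf // h2 andbT (lt_trans _ h0) // oppr_lt0 divr_gt0 ?pi_gt0.
(* The complementary angle [pi / 2 - h] changes the sign of the cosine. *)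
have eig2 : eigenvalue (laplacian R (path_graph M.+1)) (2 + 2 * t).
  have -> : 2 + 2 * t = 2 - 2 * cos (2 * (pi / 2 - h)).
    rewrite (_ : 2 * (pi / 2 - h) = pi - 2 * h); last by field.
    by rewrite cosB cospi sinpi tE; ring.
  apply: path_graph_eigenvalue => //.
    have -> : M.+1%:R * (2 * (pi / 2 - h)) = pi *+ M.
      by rewrite -mulr_natr /h -natr1; field; rewrite natr1.
    by elim: (M) => [|k IH]; rewrite ?mulr0n ?sin0 // mulrSr sinD IH sinpi; ring.
  by rewrite gt_eqF // cos_gt0_pihalf //; lra.
have B1 : 0 <= t.
  have : (B.+1%:R)^-1 <= 1 :> R by rewrite invf_le1 // ler1n.
  by move=> e1; apply: ltW (le_lt_trans _ te); rewrite subr_ge0.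
apply: lt_le_trans (graph_chi_ge (@path_graph_dist _) _ eig2 _ eig1); last 2 first.
- lra.
- by rewrite gt_eqF //; lra.
rewrite ltr_pdivlMr; last lra.
have : (1 - t) * B.+1%:R < 1 by rewrite -ltr_pdivlMr // div1r ltrBlDr -ltrBlDl.
rewrite -natr1; lra.
Qed.

(** * Two trees with a moving contact *)

Section finType_graph.
Context {T : finType} (e : rel T) (es : symmetric e) (ei : irreflexive e).

Fact finType_graph_sym : symmetric (fun i j : 'I_#|T| => e (enum_val i) (enum_val j)).
Proof. by move=> i j; rewrite es. Qed.

Fact finType_graph_irr : irreflexive (fun i j : 'I_#|T| => e (enum_val i) (enum_val j)).
Proof. by move=> i; rewrite ei. Qed.

Definition finType_graph : graph #|T| := Graph finType_graph_sym finType_graph_irr.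

Lemma finType_graph_dist D :
  (forall x y, dist_le e D x y) -> forall i j, dist_le finType_graph D i j.
Proof.
move=> eD i j; have [p [ep pl pD]] := eD (enum_val i) (enum_val j).
exists (map enum_rank p); rewrite size_map; split=> //.
  rewrite -[i]enum_valK path_map (eq_path (e' := e)) // => x y.
  by rewrite /= !enum_rankK.
by rewrite -[i]enum_valK last_map pl enum_valK.
Qed.

Lemma finType_graph_sum (R : realType) i (F : T -> R) :
  \sum_j (finType_graph i j)%:R * F (enum_val j)
    = \sum_y (e (enum_val i) y)%:R * F y.
Proof. by rewrite [RHS]big_enum_val. Qed.

Lemma finType_graph_degree (R : realType) dg :
  (forall x, \sum_y (e x y)%:R <= dg%:R :> R) ->
  forall i, (degree finType_graph i <= dg)%N.
Proof.
move=> edg i; rewrite -(ler_nat R) degreeE.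
under eq_bigr do rewrite -[(_)%:R]mulr1.
rewrite (finType_graph_sum i (fun=> 1)).
by under eq_bigr do rewrite mulr1.
Qed.

Lemma finType_graph_eigenvalue (R : realType) (c : R) (v : T -> R) (x0 : T) :
  v x0 != 0 -> (forall x, \sum_y (e x y)%:R * (v x - v y) = c * v x) ->
  eigenvalue (laplacian R finType_graph) c.
Proof.
move=> vx0 vE; apply/laplacian_eigenP; exists (v \o enum_val); split.
  by exists (enum_rank x0); rewrite /= enum_rankK.
by move=> i; rewrite (finType_graph_sum i (fun y => v (enum_val i) - v y)) vE.
Qed.

End finType_graph.

(** * Motion of the contact node *)

Section relay_schedule.
Context (N : nat).

(* The middle node in contact with both trees moves back and forth. *)
Definition contact (q : nat) : nat :=
  (if odd (q %/ N.+1) then N.-1 - q %% N.+1 else minn (q %% N.+1) N.-1)%N.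

Fact contact_lt q : (0 < N)%N -> (contact q < N)%N.
Proof. by move=> N_gt0; rewrite /contact; case: ifP => _; lia. Qed.

Lemma contact_step q : (contact q <= (contact q.+1).+1)%N /\
  (contact q.+1 <= (contact q).+1)%N.
Proof.
rewrite /contact; have := ltn_pmod q (ltn0Sn N).
set u := (q %/ N.+1)%N; set t := (q %% N.+1)%N; rewrite ltnS leq_eqVlt.
case/orP=> [/eqP tN|tN].
  have -> : q.+1 = (u.+1 * N.+1 + 0)%N.
    by rewrite (divn_eq q N.+1) -/u -/t tN; lia.
  rewrite divnMDl // modnMDl div0n mod0n addn0 /= tN; case: odd => /=; lia.
have -> : q.+1 = (u * N.+1 + t.+1)%N.
  by rewrite {1}(divn_eq q N.+1) addnS.
rewrite divnMDl // modnMDl divn_small ?modn_small // addn0; case: odd; lia.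
Qed.

(** Let [u] be the number of completed sweeps. Coordinates before [u] have had time to arrive
    everywhere and later ones have not started. For coordinate [u] the contact is at the front of
    the wave, which moves right for even [u] and left for odd [u], so one round advances it by at
    most one position. *)
Lemma arrival_contact q m p p' : (p <= N.+1)%N -> (p' <= N.+1)%N ->
  ((p <= contact q) -> (p' <= (contact q).+1))%N ->
  (((contact q).+2 <= p) -> ((contact q).+1 <= p'))%N ->
  (arrival N.+1 m p <= q)%N -> (arrival N.+1 m p' <= q.+1)%N.
Proof.
rewrite /contact /arrival => pN p'N.
have := divn_eq q N.+1; have := ltn_pmod q (ltn0Sn N).
set u := (q %/ N.+1)%N; set t := (q %% N.+1)%N => tN qE.
have [mu|um|->] := ltngtP m u.
- have : (m.+1 * N.+1 <= u * N.+1)%N by rewrite leq_mul2r mu orbT.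
  by rewrite mulSn => *; case: odd; lia.
- have : (u.+1 * N.+1 <= m * N.+1)%N by rewrite leq_mul2r um orbT.
  by rewrite mulSn => *; lia.
by case: odd; lia.
Qed.

End relay_schedule.

Lemma sum_divn (V : nmodType) (F : nat -> V) (n r : nat) :
  \sum_(0 <= l < n * r) F (l %/ r)%N = \sum_(0 <= k < n) F k *+ r.
Proof.
case: r => [|r]; first by rewrite muln0 big_nil big1.
elim: n => [|n IH]; first by rewrite mul0n !big_nil.
rewrite [RHS]big_nat_recr //= -IH mulSn addnC (@big_cat_nat _ _ _ (n * r.+1)) ?leq_addr //=.
congr (_ + _); rewrite (eq_big_nat _ _ (F2 := fun=> F n)).
  by rewrite sumr_const_nat; congr (_ *+ _); lia.
move=> l /andP[nl ln]; congr F; apply/eqP.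
by rewrite eqn_leq -ltnS ltn_divLR // leq_divRL // nl andbT; lia.
Qed.

Section twin_trees.
Context (r N : nat).

Definition node := ((bool * 'I_N) + 'I_N)%type.

Definition tree_adj (k l : nat) : bool :=
  ((0 < k) && (k %/ r == l) || (0 < l) && (l %/ r == k))%N.

(* [inl (c, k)] is the [k]-th node of the left ([c = false]) or right tree, in
   which the parent of [k > 0] is [k %/ r]; [inr k] is the [k]-th middle node,
   hanging from the left tree if [k <= s] and from the right tree if [k >= s]. *)
Definition twin_adj (s : nat) (x y : node) : bool :=
  let hang (c : bool) (k : nat) := if c then (s <= k)%N else (k <= s)%N in
  match x, y with
  | inl (c, k), inl (c', l) => (c == c') && tree_adj k l
  | inl (c, k), inr l | inr l, inl (c, k) => (k == l) && hang c k
  | inr _, inr _ => false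
  end.

(** A whole tree shares one position: travel inside a tree is free, and only crossing the middle
    nodes takes time. *)
Definition twin_pos (x : node) : nat :=
  match x with inl (c, _) => if c then N.+1 else 0 | inr k => k.+1 end.

Fact tree_adj_sym : symmetric tree_adj.
Proof. by move=> k l; rewrite /tree_adj orbC. Qed.

Fact twin_adj_sym s : symmetric (twin_adj s).
Proof.
move=> [[c k]|k] [[c' l]|l] //=; rewrite eq_sym.
by rewrite tree_adj_sym.
Qed.

Lemma twin_pos_le x : (twin_pos x <= N.+1)%N.
Proof. by case: x => [[[] k]|k] //=; exact/ltnW/ltn_ord. Qed.

Lemma twin_adj_pos s x y : (s < N)%N -> twin_adj s x y ->
  (twin_pos y <= s -> twin_pos x <= s.+1)%N /\
  (s.+2 <= twin_pos y -> s.+1 <= twin_pos x)%N.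
Proof.
move=> sN; case: x y => [[[] k]|k] [[[] l]|l] //=; try lia.
all: by case/andP=> /eqP -> ; lia.
Qed.

Lemma card_node : #|{: node}| = (3 * N)%N.
Proof. by rewrite card_sum card_prod card_bool card_ord; lia. Qed.

Context (r_gt1 : (1 < r)%N).

Fact twin_adj_irr s : irreflexive (twin_adj s).
Proof.
move=> [[c [k kN]]|k] //=; rewrite eqxx /tree_adj orbb /=.
by case: k {kN} => // k; rewrite (ltn_eqF (ltn_Pdiv _ _)).
Qed.

Definition twin_graph s : graph #|{: node}| :=
  finType_graph (twin_adj_sym s) (twin_adj_irr s).

Lemma twin_dist_root s c (k : 'I_N) (root : 'I_N) e : root = 0%N :> nat ->
  (k < r ^ e)%N -> dist_le (twin_adj s) e (inl (c, k)) (inl (c, root)).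
Proof.
move=> root0; elim: e k => [|e IH] k ke.
  have -> : k = root by apply: ord_inj; rewrite root0; move: ke; rewrite expn0; lia.
  exact: dist_le0.
have [k0|k0] := posnP k.
  have -> : k = root by apply: ord_inj; rewrite root0.
  exact: dist_le_leq (dist_le0 _ _).
have kN : (k %/ r < N)%N := leq_ltn_trans (leq_div k r) (ltn_ord k).
rewrite -add1n; apply: (@dist_le_trans _ _ _ _ _ (inl (c, Ordinal kN))).
  by apply: dist_le1; rewrite /= eqxx /tree_adj /= k0 eqxx.
by apply: IH; rewrite /= ltn_divLR ?(ltnW r_gt1) // -expnSr.
Qed.

(** Any node is within [d.+1] of a root, and the two roots are within [2 * d.+1] of each other
    through the middle node [s]. *)
Lemma twin_dist s d : N = (r ^ d)%N -> (s < N)%N ->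
  forall x y, dist_le (twin_adj s) (4 * d.+1) x y.
Proof.
move=> Nd sN; have N0 : (0 < N)%N by exact: leq_trans sN.
pose root : node -> node := fun x => inl (match x with
  | inl (c, _) => c | inr k => (s <= k)%N end, Ordinal N0).
have to_tree_root c k : dist_le (twin_adj s) d (inl (c, k)) (inl (c, Ordinal N0)).
  by apply: twin_dist_root; rewrite // -Nd.
have to_root x : dist_le (twin_adj s) d.+1 x (root x).
  case: x => [[c k]|k] /=; first exact: dist_le_leq (to_tree_root c k).
  rewrite -add1n; apply: dist_le_trans (to_tree_root _ k).
  by apply: dist_le1; rewrite /= eqxx; case: leqP => // /ltnW.
have roots c c' : dist_le (twin_adj s) (2 * d.+1) (inl (c, Ordinal N0)) (inl (c', Ordinal N0)).
  have to_mid b : dist_le (twin_adj s) d.+1 (inl (b, Ordinal N0)) (inr (Ordinal sN)).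
    rewrite -addn1; apply: (@dist_le_trans _ _ _ _ _ (inl (b, Ordinal sN))).
      exact/(dist_le_sym (twin_adj_sym s))/to_tree_root.
    by apply: dist_le1; rewrite /= eqxx leqnn if_same.
  rewrite mul2n -addnn; apply: dist_le_trans (to_mid c) _.
  exact/(dist_le_sym (twin_adj_sym s)).
move=> x y; rewrite (_ : (4 * d.+1 = d.+1 + (2 * d.+1 + d.+1))%N); last by lia.
apply: dist_le_trans (to_root x) (dist_le_trans (roots _ _) _).
exact: (dist_le_sym (twin_adj_sym s) (to_root y)).
Qed.

Lemma twin_connected s d : N = (r ^ d)%N -> (s < N)%N ->
  connected_graph (twin_graph s).
Proof.
move=> Nd sN i j; apply: dist_le_connect.
exact: (finType_graph_dist _ _ (twin_dist Nd sN)).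
Qed.

(** Tree edges never change, and a middle node that loses an edge when [s] moves by one can only be
    node [s] itself. *)
Lemma twin_edges_diff (s s' : 'I_N) : (s <= s'.+1)%N -> (s' <= s.+1)%N ->
  (#|edges (twin_graph s) :\: edges (twin_graph s')| <= 2)%N.
Proof.
move=> ss' s's.
pose rung (c : bool) : {set 'I_#|{: node}|} :=
  [set enum_rank (inl (c, s) : node); enum_rank (inr s : node)]%SET.
suff sub : edges (twin_graph s) :\: edges (twin_graph s')
    \subset [set rung true; rung false]%SET.
  by rewrite (leq_trans (subset_leq_card sub)) // cards2; case: eqP.
apply/fintype.subsetP => E /finset.setDP[/imsetP[[i j] /=]]; rewrite inE /= => ij -> {E}.
move=> /negP ij'.
have {ij'} : ~~ twin_adj s' (enum_val i) (enum_val j).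
  apply/negP => h; apply: ij'; apply/imsetP; exists (i, j) => //.
  by rewrite inE.
move: ij; rewrite /finType_graph /= => ij.
rewrite -[X in [set X; _]%SET]enum_valK -[X in [set _; X]%SET]enum_valK.
case: (enum_val i) (enum_val j) ij => [[c k]|k] [[c' l]|l] //=.
- by move=> ->.
- case/andP=> /eqP <- kc; rewrite eqxx /= => kc'.
  have -> : k = s by apply: ord_inj; case: c kc kc'; lia.
  by rewrite !inE; case: (c); rewrite eqxx ?orbT.
case/andP=> /eqP -> kc; rewrite eqxx /= => kc'.
have -> : k = s by apply: ord_inj; case: c' kc kc'; lia.
by rewrite finset.setUC !inE; case: (c'); rewrite eqxx ?orbT.
Qed.

End twin_trees.

Section twin_trees_spectrum.
Context {R : realType} (r d : nat) (r_gt1 : (1 < r)%N).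
Let N := (r ^ d.+1)%N.

Lemma sum_ord_pick (n k : nat) (F : nat -> R) : (k < n)%N ->
  \sum_(l < n) (k == l)%:R * F l = F k.
Proof.
move=> kn; rewrite (bigD1 (Ordinal kn)) //= eqxx mul1r big1 ?addr0 // => l lk.
by rewrite (_ : (k == l) = false) ?mul0r //; apply: contraNF lk => /eqP E; apply/eqP/ord_inj.
Qed.

Lemma sum_children (k : nat) :
  \sum_(l < N) (l %/ r == k)%N%:R = if (k < r ^ d)%N then r%:R else 0 :> R.
Proof.
rewrite -(big_mkord xpredT (fun l => (l %/ r == k)%N%:R)) /N expnSr.
rewrite (sum_divn (fun m => (m == k)%:R : R)).
rewrite (eq_bigr (fun m => if m == k then r%:R else 0 : R)); last first.
  by move=> m _; case: eqP => _; rewrite ?mul0rn.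
by rewrite -big_mkcond /= big_nat1_eq.
Qed.

(** Splits the neighbours into parent and children; no node is both, since division by [r] decreases
    positive numbers. *)
Lemma sum_tree_adj (k : nat) (F : nat -> R) : (k < N)%N ->
  \sum_(l < N) (tree_adj r k l)%:R * F l =
  (0 < k)%:R * F (k %/ r)%N + \sum_(l < N) ((0 < l) && (l %/ r == k))%N%:R * F l.
Proof.
move=> kN; rewrite -(@sum_ord_pick N (k %/ r) F) ?(leq_ltn_trans (leq_div _ _)) //.
rewrite mulr_sumr -big_split; apply: eq_bigr => l _ /=.
rewrite mulrA -natrM mulnb -mulrDl -natrD; congr (_%:R * _).
rewrite /tree_adj; case: (boolP (_ && _)) => //= /andP[k0 /eqP kl].
case: (boolP (_ && _)) => //= /andP[l0 /eqP lk].
have := ltn_Pdiv r_gt1 k0; have := ltn_Pdiv r_gt1 l0; rewrite lk kl; lia.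
Qed.

Lemma sum_node (F : node N -> R) : \sum_y F y =
  \sum_(l < N) F (inl (false, l)) + \sum_(l < N) F (inl (true, l))
  + \sum_(l < N) F (inr l).
Proof.
rewrite big_sumType /=; congr (_ + _).
transitivity (\sum_(c : bool) \sum_(l < N) F (inl (c, l))).
  by rewrite pair_bigA; apply: eq_bigr => -[].
by rewrite big_bool /= addrC.
Qed.

Lemma sum_ord_hang (k : 'I_N) (b : bool) (F : 'I_N -> R) :
  \sum_(l < N) ((k == l) && b)%:R * F l = b%:R * F k.
Proof.
rewrite (bigD1 k) //= eqxx big1 ?addr0 // => l /negbTE lk.
by rewrite eq_sym lk mul0r.
Qed.

Lemma sum_twin_tree s c (k : 'I_N) (F : node N -> R) :
  \sum_y (twin_adj r s (inl (c, k)) y)%:R * F y =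
  \sum_(l < N) (tree_adj r k l)%:R * F (inl (c, l))
  + (if c then s <= k else k <= s)%N%:R * F (inr k).
Proof.
rewrite sum_node /= (sum_ord_hang k _ (fun l => F (inr l))); congr (_ + _).
case: c => /=; [rewrite [X in X + _]big1 ?add0r // | rewrite [X in _ + X]big1 ?addr0 //];
  by move=> l _; rewrite mul0r.
Qed.

Lemma sum_twin_mid s (k : 'I_N) (F : node N -> R) :
  \sum_y (twin_adj r s (inr k) y)%:R * F y =
  (k <= s)%N%:R * F (inl (false, k)) + (s <= k)%N%:R * F (inl (true, k)).
Proof.
rewrite sum_node /= [X in _ + X]big1 ?addr0 => [|l _]; last by rewrite mul0r.
congr (_ + _).
  rewrite -(sum_ord_hang k _ (fun l => F (inl (false, l)))).
  apply: eq_bigr => l _; rewrite [l == k]eq_sym.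
  by case: eqP => [->|].
rewrite -(sum_ord_hang k _ (fun l => F (inl (true, l)))).
apply: eq_bigr => l _; rewrite [l == k]eq_sym.
by case: eqP => [->|].
Qed.

Lemma twin_degree s i : (degree (twin_graph N r_gt1 s) i <= r.+2)%N.
Proof.
apply: (@finType_graph_degree _ _ _ _ R) => x.
have le1 (b : bool) : b%:R * 1 <= 1 :> R by case: b; rewrite mulr1 ?ler01.
under eq_bigr do rewrite -[(_)%:R]mulr1.
case: x => [[c k]|k].
  rewrite (sum_twin_tree s c k (fun=> 1)) -[r.+2]addn1 natrD lerD //.
  rewrite (sum_tree_adj (fun=> 1)) // -[r.+1]add1n natrD lerD //.
  apply: (@le_trans _ _ (\sum_(l < N) (l %/ r == k)%N%:R)).
    by apply: ler_sum => l _; rewrite mulr1 ler_nat; case: (0 < l)%N => //=; case: eqP.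
  by rewrite sum_children; case: ifP.
rewrite (sum_twin_mid s k (fun=> 1)); apply: (@le_trans _ _ 2).
  by rewrite [2](mulr2n 1) lerD.
by rewrite ler_nat; lia.
Qed.

End twin_trees_spectrum.

(** * Eigenvectors supported on two sibling stars *)

Section twin_stars.
Context {R : realType} (r d : nat) (r_gt2 : (2 < r)%N) (r_gt1 : (1 < r)%N).
Let N := (r ^ d.+2)%N.
Context (lam : R) (lamE : lam ^+ 2 - r.+2%:R * lam + 1 = 0).

(** The last two nodes that have children. They are siblings, and all their children are leaves. *)
Let j1 := (r ^ d.+1).-1.
Let j2 := (r ^ d.+1).-2.
Let g (k : nat) : R := (k == j1)%:R - (k == j2)%:R.
(** Opposite values on the two stars, [1 - lam] at the centres and 1 at the leaves up to sign. The
    equation at a leaf is then automatic, and at a centre it is [lamE]. *)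
Let w (k : nat) : R := (1 - lam) * g k + (0 < k)%:R * g (k %/ r)%N.

Let pow_ge : (r ^ d.+1 = (r ^ d).-1 * r + r /\ 0 < r ^ d)%N.
Proof.
have p : (0 < r ^ d)%N by rewrite expn_gt0; lia.
by split=> //; rewrite -mulSnr prednK // expnSr.
Qed.

Let j1_div : (j1 %/ r = (r ^ d).-1)%N.
Proof.
have [E _] := pow_ge; rewrite /j1 E.
have -> : ((r ^ d).-1 * r + r).-1 = ((r ^ d).-1 * r + r.-1)%N by lia.
by rewrite divnMDl ?divn_small; lia.
Qed.

Let j2_div : (j2 %/ r = (r ^ d).-1)%N.
Proof.
have [E _] := pow_ge; rewrite /j2 E.
have -> : ((r ^ d).-1 * r + r).-2 = ((r ^ d).-1 * r + r.-2)%N by lia.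
by rewrite divnMDl ?divn_small; lia.
Qed.

Let j_bounds : [/\ 0 < j2, (r ^ d).-1 < j2, j2 < j1, r ^ d <= j2 & j1 < r ^ d.+1]%N.
Proof.
have [_ p] := pow_ge; have : (3 * r ^ d <= r ^ d.+1)%N by rewrite expnS leq_mul2r r_gt2 orbT.
rewrite /j1 /j2; move: (r ^ d.+1)%N (r ^ d)%N p => a b p ab ; split; lia.
Qed.

Let gP k : g k != 0 -> k = j1 \/ k = j2.
Proof.
rewrite /g; have [->|_] := eqVneq k j1; first by left.
by have [->|_] := eqVneq k j2; [right | rewrite subrr eqxx].
Qed.

Let g_small k : (k < j2)%N -> g k = 0.
Proof.
move=> kj; apply/eqP; apply: contraTT kj => /gP; have := j_bounds.
by case=> ????? [] ->; rewrite -leqNgt //; lia.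
Qed.

Let wE : forall k, (k < N)%N ->
  \sum_(l < N) (tree_adj r k l)%:R * (w k - w l) = lam * w k.
Proof.
move=> k kN; have [j20 j2r j21 rj2 j1r] := j_bounds.
rewrite (sum_tree_adj (d := d.+1) r_gt1 (fun l => w k - w l)) //.
have g0 : g 0 = 0 by exact: g_small.
have ggr : g (k %/ r %/ r) = 0.
  apply: g_small; rewrite -divnMA ltn_divLR ?muln_gt0 ?(ltnW r_gt1) //.
  by rewrite (leq_trans kN) // /N !expnSr mulnA !leq_mul2r rj2 !orbT.
have -> : (0 < k)%:R * (w k - w (k %/ r)%N) =
    w k - (0 < k)%:R * ((1 - lam) * g (k %/ r)%N).
  rewrite {2}/w ggr mulr0 addr0; case: posnP => [->|_]; last by rewrite !mul1r.
  by rewrite /w g0 /=; ring.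
have -> : \sum_(l < N) ((0 < l) && (l %/ r == k))%N%:R * (w k - w l) =
    (w k - g k) * \sum_(l < N) ((0 < l) && (l %/ r == k))%N%:R
    - (1 - lam) * \sum_(l < N) ((0 < l) && (l %/ r == k))%N%:R * g l.
  rewrite !mulr_sumr -sumrB; apply: eq_bigr => l _.
  case: (boolP (_ && _)) => [/andP[l0 /eqP lk]|_]; last by rewrite !(mul0r, mulr0) subrr.
  have -> : w l = (1 - lam) * g l + g k by rewrite /w lk l0 mul1r.
  by rewrite !mul1r mulr1; ring.
(* The contributions of [j1] and [j2] cancel at their common parent. *)
have -> : \sum_(l < N) ((0 < l) && (l %/ r == k))%N%:R * g l = 0.
  have pick j : (0 < j < N)%N -> \sum_(l < N) ((0 < l) && (l %/ r == k))%N%:R * (l == j :> nat)%:R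
      = (j %/ r == k)%N%:R :> R.
    case/andP=> j0 jN.
    transitivity (\sum_(l < N) (j == l)%:R * ((0 < l) && (l %/ r == k))%N%:R : R).
      by apply: eq_bigr => l _; rewrite mulrC eq_sym.
    by rewrite (sum_ord_pick (fun l => ((0 < l) && (l %/ r == k))%N%:R)) // j0.
  under eq_bigr do rewrite mulrBr.
  have j1N : (j1 < N)%N by rewrite (leq_trans j1r) // leq_pexp2l // ltnW.
  rewrite sumrB !pick ?j1_div ?j2_div ?subrr // ?j1N ?(ltn_trans j21) //; lia.
set S := \sum_(l < N) _.
(* [S] counts the children of [k]: a star centre has [r] of them. *)
have gS : g k * S = r%:R * g k.
  have [->|/gP kj] := eqVneq (g k) 0; first by rewrite mul0r mulr0.
  have k0 : (0 < k)%N by case: kj => ->; lia.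
  rewrite mulrC; congr (_ * _); rewrite -[RHS](_ : (if (k < r ^ d.+1)%N then r%:R else 0) = _).
    rewrite -sum_children /S; apply: eq_bigr => l _; congr (_%:R).
    by case: posnP => // l0; rewrite l0 div0n; case: eqP k0 => // <-.
  by have -> : (k < r ^ d.+1)%N by case: kj => ->; lia.
(* A child of a star centre is a leaf of the tree, so [S] vanishes there. *)
have pS : (0 < k)%:R * g (k %/ r)%N * S = 0.
  have [->|/gP kj] := eqVneq (g (k %/ r)%N) 0; first by rewrite mulr0 mul0r.
  have k_ge : (r ^ d.+1 <= k)%N.
    by rewrite expnSr -leq_divRL ?(ltnW r_gt1) //; case: kj => ->; lia.
  rewrite (_ : S = 0) ?mulr0 //; apply: big1 => l _.
  case: (boolP (_ && _)) => // /andP[_ /eqP lk].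
  have : (l < r ^ d.+1 * r)%N by rewrite -expnSr.
  by rewrite ltnNge -leq_divRL ?(ltnW r_gt1) // lk k_ge.
have -> : (w k - g k) * S = - lam * r%:R * g k.
  transitivity (- lam * (g k * S) + (0 < k)%:R * g (k %/ r)%N * S); first by rewrite /w; ring.
  by rewrite gS pS; ring.
rewrite /w; set P := (0 < k)%:R * g (k %/ r)%N.
have -> : (0 < k)%:R * ((1 - lam) * g (k %/ r)%N) = (1 - lam) * P by rewrite /P; ring.
have E : 1 - lam - lam * r%:R = lam - lam ^+ 2.
  by move: lamE; rewrite -natr1 -natr1 => lE; lra.
transitivity ((1 - lam - lam * r%:R) * g k + lam * P); first by ring.
by rewrite E; ring.
Qed.

(** At contact 0 only the root of the left tree touches a middle node, and [w] vanishes at this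
    root, so extension by zero preserves the eigenvalue equation. *)
Lemma twin_eigenvalue : eigenvalue (laplacian R (twin_graph N r_gt1 0)) lam.
Proof.
have [j20 j2r j21 rj2 j1r] := j_bounds.
have lam1 : 1 - lam != 0.
  apply/eqP => l1; have lE : lam = 1 by lra.
  have : (r.+2%:R : R) = 2 by move: lamE; rewrite lE; lra.
  by move/eqP; rewrite eqr_nat; lia.
have j1N : (j1 < N)%N by rewrite (leq_trans j1r) // leq_pexp2l // ltnW.
pose v (x : node N) : R := if x is inl (false, k) then w k else 0.
apply: (@finType_graph_eigenvalue _ _ _ _ _ _ v (inl (false, Ordinal j1N))).
  rewrite /= /w (g_small (k := (j1 %/ r)%N)) ?j1_div // mulr0 addr0 mulf_neq0 //.
  by rewrite /g eqxx (_ : j1 == j2 = false) ?subr0 ?oner_eq0 //; lia.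
have w0 : w 0 = 0 by rewrite /w div0n (g_small j20) !mulr0 addr0.
move=> [[[] k]|k].
- rewrite (sum_twin_tree 0 true k (fun y => v (inl (true, k)) - v y)) /=.
  by rewrite subrr !mulr0 addr0 big1 // => l _; rewrite mulr0.
- rewrite (sum_twin_tree 0 false k (fun y => v (inl (false, k)) - v y)) /=.
  rewrite wE // subr0 leqn0; have [->|_] := eqVneq (k : nat) 0%N.
    by rewrite w0 !mulr0 addr0.
  by rewrite mul0r addr0.
rewrite (sum_twin_mid 0 k (fun y => v (inr k) - v y)) /= !sub0r oppr0 !mulr0 addr0.
by rewrite leqn0; case: eqP => [->|_]; rewrite ?w0 ?oppr0 ?mulr0 ?mul0r.
Qed.

End twin_stars.

Lemma twin_relay_network (r d : nat) (r_gt1 : (1 < r)%N) :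
  exists (a b : 'I_#|{: node (r ^ d)}|),
  relay_network (r ^ d).+1 (fun q => twin_graph (r ^ d) r_gt1 (contact (r ^ d) q))
    (fun i => twin_pos (enum_val i)) a b.
Proof.
set N := (r ^ d)%N; have N0 : (0 < N)%N by rewrite expn_gt0 (ltnW r_gt1).
pose root c : node N := inl (c, Ordinal N0).
exists (enum_rank (root false)), (enum_rank (root true)); split=> //.
- by move=> q; apply: (@twin_connected _ _ _ _ d) => //; exact: contact_lt.
- by rewrite enum_rankK.
- by rewrite enum_rankK.
move=> q m i j /= ij.
have [h1 h2] := twin_adj_pos (contact_lt q N0) ij.
by apply: (arrival_contact (twin_pos_le _) (twin_pos_le _)).
Qed.

Lemma twin_graph_chi_le (R : realType) (r d s : nat) (r_gt2 : (2 < r)%N)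
    (r_gt1 : (1 < r)%N) : (s < r ^ d.+1)%N ->
  graph_chi R (twin_graph (r ^ d.+1) r_gt1 s) <= (96 * d.+2)%:R * r%:R ^+ d.+2.
Proof.
move=> sN; have dist := finType_graph_dist (twin_adj_sym r s) (twin_adj_irr r_gt1 s)
  (twin_dist r_gt1 erefl sN).
apply: le_trans (graph_chi_le (R := R) (twin_degree (R := R) r_gt1 s) dist) _.
(* The constant: 4 (r + 2) times 3 r^(d+1) nodes times distance 4 (d + 2), with r + 2 <= 2 r. *)
rewrite card_node -natrX -!natrM ler_nat (expnS r d.+1).
have : (r.+2 * (r ^ d.+1 * d.+2) <= 2 * r * (r ^ d.+1 * d.+2))%N.
  by rewrite leq_mul2r; apply/orP; right; lia.
move: (r ^ d.+1)%N => x; nia.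
Qed.

(** The star equation has roots [lam] and [lam^-1], both eigenvalues, so the condition number is at
    least lam^2, hence at least [lam] and more than r / 2. *)
Lemma twin_graph_chi_gt (R : realType) (r d : nat) (r_gt2 : (2 < r)%N)
    (r_gt1 : (1 < r)%N) :
  r%:R / 2 < graph_chi R (twin_graph (r ^ d.+2) r_gt1 0).
Proof.
have N0 : (0 < r ^ d.+2)%N by rewrite expn_gt0 (ltnW r_gt1).
have dist := finType_graph_dist (twin_adj_sym r 0) (twin_adj_irr r_gt1 0)
  (twin_dist r_gt1 erefl N0).
pose t : R := r.+2%:R; have t5 : 5 <= t by rewrite ler_nat; lia.
pose u := Num.sqrt (t ^+ 2 - 4).
have u2 : u ^+ 2 = t ^+ 2 - 4 by rewrite sqr_sqrtr // subr_ge0; nra.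
have u0 : 0 <= u by rewrite sqrtr_ge0.
pose lam := (t + u) / 2.
have lam_ge : t / 2 <= lam by rewrite /lam; lra.
have lam0 : 0 < lam by lra.
have lamE : lam ^+ 2 - t * lam + 1 = 0.
  by rewrite /lam; move: t u u2 {t5 u0 lam lam_ge lam0} => t u u2; lra.
have lamVE : lam^-1 ^+ 2 - t * lam^-1 + 1 = 0.
  move: (t) (lam) lamE lam0 => t' l lE l0.
  transitivity ((l ^+ 2 - t' * l + 1) / l ^+ 2); last by rewrite lE mul0r.
  by field; rewrite gt_eqF.
have eig := twin_eigenvalue d r_gt2 r_gt1 lamE.
have eigV := twin_eigenvalue d r_gt2 r_gt1 lamVE.
apply: lt_le_trans (graph_chi_ge dist (ltW lam0) eig _ eigV); last first.
  by rewrite gt_eqF // invr_gt0.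
rewrite invrK; apply: (@lt_le_trans _ _ lam).
  by apply: lt_le_trans lam_ge; rewrite ltr_pM2r // ltr_nat; lia.
by rewrite ler_peMr ?(ltW lam0) //; lra.
Qed.

(** * Choice of the networks *)

Theorem corollary3p6 (R : realType) (d : nat) (d_gt0 : (0 < d)%N) :
  exists c : R, 0 < c /\
  forall L mu : R, 0 < mu -> mu <= L -> 24 * mu < L ->
  forall B : nat,
  exists (P : problem R) (xs : ell2 R),
    [/\ smooth L (global P), strongly_convex mu (global P),
        B%:R < chi P, (B < P)%N & Delta P <= (12 * (d - 1))%:R] /\
    minimizer (global P) xs /\
    exists eps0 : R, 0 < eps0 /\
    forall eps : R, 0 < eps < eps0 ->
    forall (A : algorithm P) (k : nat) (i : 'I_P) (x : ell2 R),
      amem A k i x -> `|x - xs| ^+ 2 <= eps ->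
      c * (chi P `^ (d%:R / d.+1%:R) * Num.sqrt (L / mu) * ln (1 / eps))
        <= (rounds (acomm A) k)%:R.
Proof.
case: d d_gt0 => [//|[|d]] _.
  exists (16 * 16)^-1; split=> [|L mu mu0 _ muL B]; first by rewrite invr_gt0.
  have [n0 chi_gt] := path_graph_chi_gt R B; set M := maxn n0 B.+1.
  have M0 : (0 < M)%N by rewrite leq_max orbT.
  apply: (@relay_network_bound _ _ _ _ _ _ _ _ M _ _ _ _ _ mu0 muL (path_relay_network M0)).
  - by rewrite ler1n.
  - by rewrite ltnS (leq_trans (leqnSn B)) // leq_maxr.
  - by rewrite expn1.
  - by move=> _; exact: path_graph_chi_le.
  - by exists 0%N; apply: chi_gt; rewrite leq_maxl.
  by move=> _; rewrite finset.setDv finset.setU0 cards0.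
have C1 : 1 <= (96 * d.+3)%:R :> R by rewrite ler1n.
exists (16 * (96 * d.+3)%:R)^-1; split=> [|L mu mu0 _ muL B].
  by rewrite invr_gt0 mulr_gt0 // (lt_le_trans _ C1).
(* Large enough for r / 2 to exceed [B], and for the number of nodes as well. *)
pose r := (2 * B + 3)%N; have r_gt2 : (2 < r)%N by rewrite /r; lia.
have r_gt1 : (1 < r)%N by exact: ltnW.
have N0 : (0 < r ^ d.+2)%N by rewrite expn_gt0 (ltnW r_gt1).
have [a [b net]] := twin_relay_network d.+2 r_gt1.
apply: (@relay_network_bound _ _ _ _ _ _ _ _ r _ _ _ _ C1 mu0 muL net).
- rewrite card_node; have : (r ^ 1 <= r ^ d.+2)%N by rewrite leq_exp2l.
  by rewrite expn1 /r; lia.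
- exact: leqnSn.
- by move=> q; apply: twin_graph_chi_le => //; exact: contact_lt.
(* The schedule starts with the contact at 0, the position for which the eigenvectors were
   computed. *)
- exists 0%N; rewrite (_ : contact _ 0 = 0%N); last by rewrite /contact div0n mod0n min0n.
  apply: lt_trans (twin_graph_chi_gt R d r_gt2 r_gt1).
  by rewrite ltr_pdivlMr // -natrM ltr_nat /r; lia.
(* At most two edges are lost and two gained per round, a total below 12. *)
move=> q; have [qq' q'q] := contact_step (r ^ d.+2)%N q.
have h := @twin_edges_diff r (r ^ d.+2) r_gt1
  (Ordinal (contact_lt q N0)) (Ordinal (contact_lt q.+1 N0)) qq' q'q.
have h' := @twin_edges_diff r (r ^ d.+2) r_gt1
  (Ordinal (contact_lt q.+1 N0)) (Ordinal (contact_lt q N0)) q'q qq'.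
by rewrite (leq_trans (leq_card_setU _ _)) // (leq_trans (leq_add h h')) //; lia.
Qed.
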